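(* Let $k$ be an algebraically closed field. Let $\mathbb{G}$ be a linearly reductive quantum group over $k$ (i.e. $\mathcal{O}(\mathbb{G})$ is a cosemisimple Hopf algebra over $k$), and let $\mathbb{H}\le\mathbb{G}$ be a quantum subgroup, given by a surjective Hopf algebra morphism $\pi:\mathcal{O}(\mathbb{G})\to\mathcal{O}(\mathbb{H})$, which is left-normal or right-normal. Assume that the squared antipode $S^2$ of $\mathcal{O}(\mathbb{H})$ leaves invariant every simple subcoalgebra of $\mathcal{O}(\mathbb{H})$. Then $\mathbb{H}$ is linearly reductive (i.e. $\mathcal{O}(\mathbb{H})$ is cosemisimple) and $\mathbb{H}$ is normal in $\mathbb{G}$ (i.e. both left-normal and right-normal).
   Context: All algebras, coalgebras and Hopf algebras are over a fixed algebraically closed field $k$. A (linear algebraic) quantum group $\mathbb{G}$ is a formal object dual to a Hopf algebra $\mathcal{O}(\mathbb{G})$. A quantum subgroup (embedding) $\mathbb{H}\le\mathbb{G}$ means a surjective Hopf algebra morphism $\pi:\mathcal{O}(\mathbb{G})\to\mathcal{O}(\mathbb{H})$. $\mathbb{G}$ is linearly reductive if $\mathcal{O}(\mathbb{G})$ is cosemisimple, i.e. every comodule is a direct sum of simple comodules; equivalently $\mathcal{O}(\mathbb{G})$ is a direct sum of simple subcoalgebras. Sweedler notation: $\Delta(x)=x_1\otimes x_2$, $(\Delta\otimes\mathrm{id})\Delta(x)=x_1\otimes x_2\otimes x_3$. $S$ denotes the antipode. The quantum subgroup $\mathbb{H}\le\mathbb{G}$ is: - left-normal if the left adjoint coaction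 $\mathrm{ad}_l:\mathcal{O}(\mathbb{G})\to\mathcal{O}(\mathbb{G})\otimes\mathcal{O}(\mathbb{G})$, $x\mapsto x_1S(x_3)\otimes x_2$, descends along $\pi$ to a left $\mathcal{O}(\mathbb{G})$-comodule structure on $\mathcal{O}(\mathbb{H})$ making $\pi$ a morphism of left $\mathcal{O}(\mathbb{G})$-comodules; that is, $\mathrm{ad}_l(\ker\pi)\subseteq\mathcal{O}(\mathbb{G})\otimes\ker\pi$; - right-normal if the right adjoint coaction $\mathrm{ad}_r:x\mapsto x_2\otimes S(x_1)x_3$ similarly descends along $\pi$ to a right $\mathcal{O}(\mathbb{G})$-comodule structure on $\mathcal{O}(\mathbb{H})$; that is, $\mathrm{ad}_r(\ker\pi)\subseteq\ker\pi\otimes\mathcal{O}(\mathbb{G})$; - normal if it is both left-normal and right-normal. *)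

(* Defs.v *)
From HB Require Import structures.
Set Warnings "-notation-overridden,-ambiguous-paths,-redundant-canonical-projection".
From mathcomp Require Import all_boot all_algebra.
From mathcomp Require Import boolp classical_sets.

Set Implicit Arguments.
Unset Strict Implicit.
Unset Printing Implicit Defensive.

Import GRing.Theory.
Local Open Scope ring_scope.
Local Open Scope quotient_scope.
Local Open Scope classical_set_scope.

Reserved Notation "x ⊗ y" (at level 40, left associativity).

(* The tensor product of V and W is the quotient of the formal sums            *)
(* sum_i v_i (x) w_i, encoded as sequences of pairs, that identifies two sums   *)
(* when no bilinear map can tell them apart. Lemmas tlift_pure, tlift_linear   *)
(* and tensor_ext below are its universal property.                            *)
Definition tens_eq (k : fieldType) (V W : lmodType k) (s t : seq (V * W)) :=
  `[< forall (U : lmodType k) (b : {bilinear V -> W -> U}),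
        \sum_(x <- s) b x.1 x.2 = \sum_(x <- t) b x.1 x.2 >].

Lemma tens_eqP (k : fieldType) (V W : lmodType k) (s t : seq (V * W)) :
  reflect (forall (U : lmodType k) (b : {bilinear V -> W -> U}),
             \sum_(x <- s) b x.1 x.2 = \sum_(x <- t) b x.1 x.2)
          (tens_eq s t).
Proof. exact: asboolP. Qed.

Lemma tens_eq_refl (k : fieldType) (V W : lmodType k) :
  reflexive (@tens_eq k V W).
Proof. by move=> s; apply/tens_eqP. Qed.

Lemma tens_eq_sym (k : fieldType) (V W : lmodType k) :
  symmetric (@tens_eq k V W).
Proof. by move=> s t; apply/tens_eqP/tens_eqP => st U b; rewrite st. Qed.

Lemma tens_eq_trans (k : fieldType) (V W : lmodType k) :
  transitive (@tens_eq k V W).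
Proof.
move=> t s u /tens_eqP st /tens_eqP tu.
by apply/tens_eqP => U b; rewrite st tu.
Qed.

Canonical tens_equiv (k : fieldType) (V W : lmodType k) :=
  EquivRel (@tens_eq k V W) (@tens_eq_refl k V W) (@tens_eq_sym k V W)
    (@tens_eq_trans k V W).

Definition tensor (k : fieldType) (V W : lmodType k) :=
  {eq_quot @tens_equiv k V W}.

Notation "V ⊗ W" := (@tensor _ V%type W%type) : type_scope.

HB.instance Definition _ (k : fieldType) (V W : lmodType k) :=
  Choice.on (V ⊗ W)%type.
HB.instance Definition _ (k : fieldType) (V W : lmodType k) :=
  EqQuotient.on (V ⊗ W)%type.

(* The linear extension of b to V ⊗ W, meaningful only when b is bilinear. *)
Definition tlift (k : fieldType) (V W U : lmodType k) (b : V -> W -> U)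
  (t : V ⊗ W) : U := \sum_(x <- repr t) b x.1 x.2.

Definition pure (k : fieldType) (V W : lmodType k) (v : V) (w : W) : V ⊗ W :=
  \pi_(V ⊗ W) [:: (v, w)].

Notation "v ⊗ w" := (pure v w) : ring_scope.

Section TensorModule.
Context (k : fieldType) (V W : lmodType k).
Implicit Types (s : seq (V * W)) (t : V ⊗ W).

Lemma tlift_pi (U : lmodType k) (b : {bilinear V -> W -> U}) s :
  tlift b (\pi_(V ⊗ W) s) = \sum_(x <- s) b x.1 x.2.
Proof.
have /eqmodP/tens_eqP : repr (\pi_(V ⊗ W) s) = s %[mod V ⊗ W].
  by rewrite reprK.
exact.
Qed.

Lemma tlift_inj t1 t2 :
  (forall (U : lmodType k) (b : {bilinear V -> W -> U}),
     tlift b t1 = tlift b t2) -> t1 = t2.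
Proof.
move=> eq12; rewrite -[t1]reprK -[t2]reprK; apply/eqmodP/tens_eqP => U b.
exact: eq12.
Qed.

Definition tadd t1 t2 : V ⊗ W := \pi_(V ⊗ W) (repr t1 ++ repr t2).
Definition tzero : V ⊗ W := \pi_(V ⊗ W) [::].
Definition tscale (a : k) t : V ⊗ W := \pi_(V ⊗ W) [seq (a *: x.1, x.2) | x <- repr t].

Lemma tlift_add (U : lmodType k) (b : {bilinear V -> W -> U}) t1 t2 :
  tlift b (tadd t1 t2) = tlift b t1 + tlift b t2.
Proof. by rewrite tlift_pi big_cat. Qed.

Lemma tlift_zero (U : lmodType k) (b : {bilinear V -> W -> U}) :
  tlift b tzero = 0.
Proof. by rewrite tlift_pi big_nil. Qed.

Lemma tlift_scale (U : lmodType k) (b : {bilinear V -> W -> U}) a t :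
  tlift b (tscale a t) = a *: tlift b t.
Proof.
rewrite tlift_pi big_map scaler_sumr; apply: eq_bigr => x _ /=.
by rewrite linearZl_LR.
Qed.

Let tliftE := (tlift_add, tlift_zero, tlift_scale).

Fact taddA : associative tadd.
Proof. by move=> t1 t2 t3; apply: tlift_inj => U b; rewrite !tliftE addrA. Qed.

Fact taddC : commutative tadd.
Proof. by move=> t1 t2; apply: tlift_inj => U b; rewrite !tliftE addrC. Qed.

Fact tadd0 : left_id tzero tadd.
Proof. by move=> t; apply: tlift_inj => U b; rewrite !tliftE add0r. Qed.

Fact taddN : left_inverse tzero (tscale (-1)) tadd.
Proof.
by move=> t; apply: tlift_inj => U b; rewrite !tliftE scaleN1r addNr.
Qed.

HB.instance Definition _ :=
  GRing.isZmodule.Build (V ⊗ W)%type taddA taddC tadd0 taddN.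

Fact tscaleA a c t : tscale a (tscale c t) = tscale (a * c) t.
Proof. by apply: tlift_inj => U b; rewrite !tliftE scalerA. Qed.

Fact tscale1 : left_id 1 tscale.
Proof. by move=> t; apply: tlift_inj => U b; rewrite !tliftE scale1r. Qed.

Fact tscaleDr : right_distributive tscale +%R.
Proof. by move=> a t1 t2; apply: tlift_inj => U b; rewrite !tliftE scalerDr. Qed.

Fact tscaleDl t : {morph tscale^~ t : a c / a + c}.
Proof. by move=> a c; apply: tlift_inj => U b; rewrite !tliftE scalerDl. Qed.

HB.instance Definition _ :=
  GRing.Zmodule_isLmodule.Build k (V ⊗ W)%type tscaleA tscale1 tscaleDr
    tscaleDl.

Lemma tlift_linear (U : lmodType k) (b : {bilinear V -> W -> U}) :
  linear (tlift b).
Proof. by move=> a t1 t2; rewrite tlift_add tlift_scale. Qed.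

Lemma tlift_pure (U : lmodType k) (b : {bilinear V -> W -> U}) v w :
  tlift b (v ⊗ w) = b v w.
Proof. by rewrite tlift_pi big_seq1. Qed.

Lemma pure_bilinear : bilinear_for *:%R *:%R (@pure k V W).
Proof.
split=> [w|v] a x y; apply: tlift_inj => U b;
  by rewrite tlift_linear !tlift_pure ?linearPl ?linearPr.
Qed.

HB.instance Definition _ :=
  bilinear_isBilinear.Build k V W (V ⊗ W)%type *:%R *:%R (@pure k V W)
    pure_bilinear.

Lemma tensor_sum t : exists s : seq (V * W), t = \sum_(x <- s) x.1 ⊗ x.2.
Proof.
exists (repr t); apply: tlift_inj => U b.
rewrite (big_morph (tlift b) (id1 := 0) (op1 := +%R) (@tlift_add U b)
  (@tlift_zero U b)).
by apply: eq_bigr => x _; rewrite tlift_pure.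
Qed.

Lemma tensor_ext (U : lmodType k) (f g : {linear (V ⊗ W)%type -> U}) :
  (forall v w, f (v ⊗ w) = g (v ⊗ w)) -> f =1 g.
Proof.
move=> fg t; have [s ->] := tensor_sum t.
by rewrite !linear_sum; apply: eq_bigr => x _; apply: fg.
Qed.

End TensorModule.

Definition bilinear_map (k : fieldType) (V W U : lmodType k)
    (b : V -> W -> U) (bb : bilinear_for *:%R *:%R b) : {bilinear V -> W -> U} :=
  HB.pack b (bilinear_isBilinear.Build k V W U *:%R *:%R b bb).

Lemma tlift_pureE (k : fieldType) (V W U : lmodType k) (b : V -> W -> U)
    (bb : bilinear_for *:%R *:%R b) v w : tlift b (v ⊗ w) = b v w.
Proof. exact: (tlift_pure (bilinear_map bb)). Qed.

Lemma tlift_linearE (k : fieldType) (V W U : lmodType k) (b : V -> W -> U)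
    (bb : bilinear_for *:%R *:%R b) : linear (tlift b).
Proof. exact: (tlift_linear (bilinear_map bb)). Qed.

(* Trilinear maps extend to (U ⊗ V) ⊗ W. *)
Definition tlift3 (k : fieldType) (U V W X : lmodType k)
    (b : U -> V -> W -> X) : (U ⊗ V) ⊗ W -> X :=
  tlift (fun t w => tlift (fun u v => b u v w) t).

Lemma tlift3_pureE (k : fieldType) (U V W X : lmodType k)
    (b : U -> V -> W -> X) :
  (forall w, bilinear_for *:%R *:%R (fun u v => b u v w)) ->
  (forall u v, linear (b u v)) ->
  forall u v w, tlift3 b ((u ⊗ v) ⊗ w) = b u v w.
Proof.
move=> b12 b3 u v w; rewrite /tlift3 tlift_pureE ?tlift_pureE //.
split=> [w' | t] a x y; first exact: tlift_linearE.
rewrite /tlift /= scaler_sumr -big_split; apply: eq_bigr => z _.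
exact: b3.
Qed.

Definition tmap (k : fieldType) (V V' W W' : lmodType k)
    (f : V -> V') (g : W -> W') : V ⊗ W -> V' ⊗ W' :=
  tlift (fun v w => f v ⊗ g w).

Lemma tmap_pure (k : fieldType) (V V' W W' : lmodType k)
    (f : {linear V -> V'}) (g : {linear W -> W'}) v w :
  tmap f g (v ⊗ w) = f v ⊗ g w.
Proof.
by rewrite /tmap tlift_pureE //; split=> ? a x y;
  rewrite linearP ?linearPl ?linearPr.
Qed.

Definition tassoc (k : fieldType) (U V W : lmodType k) :
    (U ⊗ V) ⊗ W -> U ⊗ (V ⊗ W) :=
  tlift3 (fun u v w => u ⊗ (v ⊗ w)).

Lemma tassoc_pure (k : fieldType) (U V W : lmodType k)
    (u : U) (v : V) (w : W) : tassoc ((u ⊗ v) ⊗ w) = u ⊗ (v ⊗ w).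
Proof.
apply: tlift3_pureE => [w' | u' v' a x y]; last by rewrite !linearPr.
by split=> [v' | u'] a x y; rewrite !linearPl ?linearPr.
Qed.

(* Multiplication of the algebra A ⊗ B. *)
Definition tmul (k : fieldType) (A B : algType k) (s t : A ⊗ B) : A ⊗ B :=
  tlift (fun a b => tlift (fun a' b' => (a * a') ⊗ (b * b')) t) s.

Lemma tmul_pure (k : fieldType) (A B : algType k) (a a' : A) (b b' : B) :
  tmul (a ⊗ b) (a' ⊗ b') = (a * a') ⊗ (b * b').
Proof.
have bilr (c : A) (d : B) :
    bilinear_for *:%R *:%R (fun c' d' => (c * c') ⊗ (d * d')).
  split=> ? e x y; first by rewrite mulrDr -scalerAr linearPl.
  by rewrite mulrDr -scalerAr linearPr.
rewrite /tmul tlift_pureE ?tlift_pureE //.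
split=> [d | c] e x y; rewrite /tlift /= scaler_sumr -big_split;
  apply: eq_bigr => z _ /=.
  by rewrite mulrDl -scalerAl linearPl.
by rewrite mulrDl -scalerAl linearPr.
Qed.

(* The image of N ⊗ P in V ⊗ W; over a field it is N ⊗ P itself. *)
Definition tens_sub (k : fieldType) (V W : lmodType k)
    (N : set V) (P : set W) : set (V ⊗ W) :=
  [set t | exists2 s : seq (V * W),
     (forall x, x \in s -> N x.1 /\ P x.2) & t = \sum_(x <- s) x.1 ⊗ x.2].

HB.mixin Record isCoalgebra (k : fieldType) C of GRing.Lmodule k C := {
  comul : {linear C -> (C ⊗ C)%type};
  counit : {scalar C};
  comulA : forall x : C,
    tassoc (tmap comul idfun (comul x)) = tmap idfun comul (comul x);
  comul_counitl : forall x : C,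
    tlift (fun a b : C => counit a *: b) (comul x) = x;
  comul_counitr : forall x : C,
    tlift (fun a b : C => counit b *: a) (comul x) = x
}.

#[short(type="coalgType")]
HB.structure Definition Coalgebra (k : fieldType) :=
  {C of GRing.Lmodule k C & isCoalgebra k C}.

HB.mixin Record isBialgebra (k : fieldType) A
    of GRing.Algebra k A & Coalgebra k A := {
  comulM : forall x y : A, comul (x * y) = tmul (comul x) (comul y);
  comul1 : comul (1 : A) = 1 ⊗ 1;
  counitM : forall x y : A, counit (x * y) = counit x * counit y;
  counit1 : counit (1 : A) = 1
}.

#[short(type="bialgType")]
HB.structure Definition Bialgebra (k : fieldType) :=
  {A of GRing.Algebra k A & Coalgebra k A & isBialgebra k A}.

HB.mixin Record isHopfAlgebra (k : fieldType) A of Bialgebra k A := {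
  antipode : {linear A -> A};
  antipodel : forall x : A,
    tlift (fun a b : A => antipode a * b) (comul x) = counit x *: 1;
  antipoder : forall x : A,
    tlift (fun a b : A => a * antipode b) (comul x) = counit x *: 1
}.

#[short(type="hopfAlgType")]
HB.structure Definition HopfAlgebra (k : fieldType) :=
  {A of Bialgebra k A & isHopfAlgebra k A}.

Definition hopf_morphism (k : fieldType) (A B : hopfAlgType k)
    (f : {lrmorphism A -> B}) : Prop :=
  [/\ forall x, comul (f x) = tmap f f (comul x),
      forall x, counit (f x) = counit x
    & forall x, antipode (f x) = f (antipode x)].

Definition subspace (k : fieldType) (V : lmodType k) (N : set V) : Prop :=
  N 0 /\ forall (a : k) u v, N u -> N v -> N (a *: u + v).

Definition subcoalgebra (k : fieldType) (C : coalgType k) (D : set C) : Prop :=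
  subspace D /\ forall x, D x -> tens_sub D D (comul x).

(* N is minimal among the nonzero subspaces satisfying sub. *)
Definition simple_for (k : fieldType) (M : lmodType k)
    (sub : set M -> Prop) (N : set M) : Prop :=
  [/\ sub N, N <> [set 0]
    & forall P : set M, sub P -> P `<=` N -> P = [set 0] \/ P = N].

Definition simple_subcoalgebra (k : fieldType) (C : coalgType k)
    (D : set C) : Prop := simple_for (@subcoalgebra k C) D.

Definition right_comodule (k : fieldType) (C : coalgType k) (M : lmodType k)
    (rho : {linear M -> (M ⊗ C)%type}) : Prop :=
  (forall m, tassoc (tmap rho idfun (rho m)) = tmap idfun comul (rho m)) /\
  (forall m, tlift (fun n (c : C) => counit c *: n) (rho m) = m).

Definition left_comodule (k : fieldType) (C : coalgType k) (M : lmodType k)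
    (rho : {linear M -> (C ⊗ M)%type}) : Prop :=
  (forall m, tassoc (tmap comul idfun (rho m)) = tmap idfun rho (rho m)) /\
  (forall m, tlift (fun (c : C) n => counit c *: n) (rho m) = m).

Definition right_subcomodule (k : fieldType) (C : coalgType k)
    (M : lmodType k) (rho : {linear M -> (M ⊗ C)%type}) (N : set M) : Prop :=
  subspace N /\ forall m, N m -> tens_sub N setT (rho m).

Definition left_subcomodule (k : fieldType) (C : coalgType k)
    (M : lmodType k) (rho : {linear M -> (C ⊗ M)%type}) (N : set M) : Prop :=
  subspace N /\ forall m, N m -> tens_sub setT N (rho m).

Definition direct_sum (k : fieldType) (M : lmodType k) (I : choiceType)
    (N : I -> set M) : Prop :=
  (forall m, exists (s : seq I) (f : I -> M),
     (forall i, N i (f i)) /\ m = \sum_(i <- s) f i) /\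
  (forall (s : seq I) (f : I -> M), uniq s -> (forall i, N i (f i)) ->
     \sum_(i <- s) f i = 0 -> forall i, i \in s -> f i = 0).

Definition direct_sum_of_simples (k : fieldType) (M : lmodType k)
    (sub : set M -> Prop) : Prop :=
  exists (I : choiceType) (N : I -> set M),
    (forall i, simple_for sub (N i)) /\ direct_sum N.

Definition cosemisimple (k : fieldType) (C : coalgType k) : Prop :=
  (forall (M : lmodType k) (rho : {linear M -> (M ⊗ C)%type}),
     right_comodule rho -> direct_sum_of_simples (right_subcomodule rho)) /\
  (forall (M : lmodType k) (rho : {linear M -> (C ⊗ M)%type}),
     left_comodule rho -> direct_sum_of_simples (left_subcomodule rho)).

(* x_1 ⊗ x_2 ⊗ x_3 in Sweedler notation. *)
Definition comul3 (k : fieldType) (C : coalgType k) (x : C) : (C ⊗ C) ⊗ C :=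
  tmap comul idfun (comul x).

Definition adl (k : fieldType) (A : hopfAlgType k) (x : A) : A ⊗ A :=
  tlift3 (fun a b c : A => (a * antipode c) ⊗ b) (comul3 x).

Definition adr (k : fieldType) (A : hopfAlgType k) (x : A) : A ⊗ A :=
  tlift3 (fun a b c : A => b ⊗ (antipode a * c)) (comul3 x).

Definition left_normal (k : fieldType) (A B : hopfAlgType k)
    (p : {lrmorphism A -> B}) : Prop :=
  exists rho : {linear B -> (A ⊗ B)%type},
    left_comodule rho /\ forall x, rho (p x) = tmap idfun p (adl x).

Definition right_normal (k : fieldType) (A B : hopfAlgType k)
    (p : {lrmorphism A -> B}) : Prop :=
  exists rho : {linear B -> (B ⊗ A)%type},
    right_comodule rho /\ forall x, rho (p x) = tmap p idfun (adr x).

(* Main.v *)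
From HB Require Import structures.
Require Import Defs.
Set Warnings "-notation-overridden,-ambiguous-paths,-redundant-canonical-projection".
From mathcomp Require Import all_boot all_algebra.
From mathcomp Require Import boolp classical_sets.

Set Implicit Arguments.
Unset Strict Implicit.
Unset Printing Implicit Defensive.

Import GRing.Theory.
Local Open Scope ring_scope.
Local Open Scope classical_set_scope.

(** Write [A] and [B] for the two Hopf algebras and [S] for their antipodes.

    A Hopf algebra is cosemisimple if and only if it has an integral, a functional
    [h] with [h 1 = 1] that is invariant under translation: semisimplicity of the
    regular comodule gives one ([cosemisimple_right_integral]), and conversely
    averaging over [h] splits every subcomodule off ([maschke], [semisimple]). So
    the task is to produce an integral on [B] out of one on [A].

    Suppose that [p] is right-normal. The invariants [K] of [A] under right
    translation by the subgroup are then also left invariants ([invariants_left]),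
    so that [K] is a right subcomodule of [A], on which [p] is the counit. Let [L]
    be a complementary subcomodule. Then [B] is spanned by [1] and the image of
    [L], and a functional that kills this image and takes the value [1] at [1] is
    an integral. It exists unless [p l = 1] for some [l] in [L], which is excluded
    as follows ([unit_notin_kernel]). Take a [B]-subcomodule [V] of [L] of least
    finite dimension whose image contains [1], and a simple subcomodule [T] of it.
    If [T] is trivial, it lies both in [K] and in [L], which is absurd. Otherwise
    a central functional [w] on [B] with [w 1 = 1] kills [T] ([trivial_or_killed]);
    it acts on [V] by an endomorphism whose image still maps onto [1], and is
    smaller than [V].

    To find [w], let [D] be the simple subcoalgebra of coefficients of [T], a
    matrix coalgebra by Burnside's theorem ([burnside], [coef_free]). As [S \o S]
    maps [D] to itself, it is implemented on the dual matrix algebra by a nonzero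
    matrix, and the corresponding twisted trace is a nonzero element of [D]
    invariant under the adjoint coaction ([twisted_character]). The adjoint
    coaction of [B] extends to a coaction of [A] by normality; since [A] has an
    integral, the elements of [B] that are invariant under [B] split off, which
    provides a central functional with prescribed values on them
    ([central_of_central], [central_of_invariant]). The one that takes the value
    [1] at the twisted trace and [0] at [1] acts on [T] by a nonzero scalar, and
    [w] is a combination of it with the counit.

    Two-sided normality rests on the formula
    [S x2 ⊗ S (x1 * S x3)] for the right adjoint coaction of [S x]: since [S] is
    injective on any Hopf algebra with an integral ([antipode_injective]), an
    element of the kernel of [p] is mapped by the left adjoint coaction into the
    tensors whose second leg is in the kernel ([adlp_kernel]).

    A left-normal [p] becomes right-normal when products and coproducts of [A] and
    [B] are reversed, which keeps the antipodes, the integrals and the simple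
    subcoalgebras ([opcop]). The same device turns left comodules into right
    ones. *)

(** * Unbundled linear maps and sums over tensors *)

(** Linearity is kept as a predicate on plain functions, so that it can be
    proved by recursion on the body of a [fun]. *)
Definition lin (k : fieldType) (V U : lmodType k) (f : V -> U) : Prop :=
  forall a x y, f (a *: x + y) = a *: f x + f y.

Notation linf f := (@lin _ _ (GRing.regular _) f).

Definition bilin (k : fieldType) (V W U : lmodType k) (F : V -> W -> U) : Prop :=
  (forall w, lin (F^~ w)) /\ (forall v, lin (F v)).

Section Lin.
Context (k : fieldType).
Implicit Types U V W X : lmodType k.

Lemma lin0 V U (f : V -> U) : lin f -> f 0 = 0.
Proof.
by move=> lf; have := lf (-1) 0 0; rewrite scaler0 addr0 scaleN1r addNr.
Qed.

Lemma linD V U (f : V -> U) : lin f -> {morph f : x y / x + y}.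
Proof. by move=> lf x y; have := lf 1 x y; rewrite !scale1r. Qed.

Lemma linZ V U (f : V -> U) : lin f -> forall a, {morph f : x / a *: x}.
Proof. by move=> lf a x; have := lf a x 0; rewrite (lin0 lf) !addr0. Qed.

Lemma linB V U (f : V -> U) : lin f -> {morph f : x y / x - y}.
Proof. by move=> lf x y; rewrite -scaleN1r linD // linZ // scaleN1r. Qed.

Lemma lin_sum V U (f : V -> U) I (r : seq I) (P : pred I) (F : I -> V) :
  lin f -> f (\sum_(i <- r | P i) F i) = \sum_(i <- r | P i) f (F i).
Proof. by move=> lf; apply: big_morph; [exact: linD | exact: lin0]. Qed.

Definition linmap V U (f : V -> U) (lf : lin f) : {linear V -> U} :=
  HB.pack f (GRing.isLinear.Build k V U *:%R f lf).

Lemma lin_linear V U (f : {linear V -> U}) : lin f.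
Proof. by move=> a x y; rewrite linearP. Qed.

Lemma lin_scalar V (f : {scalar V}) : linf f.
Proof. by move=> a x y; rewrite linearP. Qed.

Lemma lin_id V : lin (fun x : V => x).
Proof. by []. Qed.

Lemma lin_cst0 V U : lin (fun _ : V => 0 : U).
Proof. by move=> a x y; rewrite scaler0 addr0. Qed.

Lemma lin_comp V U X (f : U -> X) (g : V -> U) :
  lin f -> lin g -> lin (fun x => f (g x)).
Proof. by move=> lf lg a x y; rewrite lg lf. Qed.

Lemma lin_add V U (f g : V -> U) : lin f -> lin g -> lin (fun x => f x + g x).
Proof. by move=> lf lg a x y; rewrite lf lg scalerDr addrACA. Qed.

Lemma lin_opp V U (f : V -> U) : lin f -> lin (fun x => - f x).
Proof. by move=> lf a x y; rewrite lf opprD scalerN. Qed.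

Lemma lin_scalel V U (f : V -> k) (u : U) : linf f -> lin (fun x => f x *: u).
Proof. by move=> lf a x y; rewrite lf scalerDl scalerA. Qed.

Lemma lin_scaler V U (a : k) (g : V -> U) : lin g -> lin (fun x => a *: g x).
Proof. by move=> lg b x y; rewrite lg scalerDr !scalerA mulrC. Qed.

Lemma lin_mull V (A : algType k) (f : V -> A) (c : A) :
  lin f -> lin (fun x => f x * c).
Proof. by move=> lf a x y; rewrite lf mulrDl scalerAl. Qed.

Lemma lin_mulr V (A : algType k) (f : V -> A) (c : A) :
  lin f -> lin (fun x => c * f x).
Proof. by move=> lf a x y; rewrite lf mulrDr scalerAr. Qed.

Lemma lin_kmull V (f : V -> k) (c : k) : linf f -> linf (fun x => f x * c).
Proof. by move=> lf a x y; rewrite lf mulrDl -mulrA. Qed.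

Lemma lin_kmulr V (f : V -> k) (c : k) : linf f -> linf (fun x => c * f x).
Proof. by move=> lf a x y; rewrite lf mulrDr mulrCA. Qed.

Lemma lin_purel V U W (f : V -> U) (w : W) : lin f -> lin (fun x => f x ⊗ w).
Proof. by move=> lf a x y; rewrite lf linearPl. Qed.

Lemma lin_purer V U W (f : V -> W) (u : U) : lin f -> lin (fun x => u ⊗ f x).
Proof. by move=> lf a x y; rewrite lf linearPr. Qed.

Lemma lin_bigsum V U I (r : seq I) (P : pred I) (F : I -> V -> U) :
  (forall i, lin (F i)) -> lin (fun x => \sum_(i <- r | P i) F i x).
Proof.
move=> lF a x y; rewrite scaler_sumr -big_split.
by apply: eq_bigr => i _; exact: lF.
Qed.

Lemma linfZ V (f : V -> k) a x : linf f -> f (a *: x) = a * f x.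
Proof. by move=> lf; rewrite (linZ lf). Qed.

Lemma linfD V (f : V -> k) x y : linf f -> f (x + y) = f x + f y.
Proof. by move=> lf; rewrite (linD lf). Qed.

Lemma linfB V (f : V -> k) x y : linf f -> f (x - y) = f x - f y.
Proof. by move=> lf; rewrite (linB lf). Qed.

Lemma linf0 V (f : V -> k) : linf f -> f 0 = 0.
Proof. by move=> lf; rewrite (lin0 lf). Qed.

Lemma linf_sum V (f : V -> k) I (r : seq I) (P : pred I) (F : I -> V) :
  linf f -> f (\sum_(i <- r | P i) F i) = \sum_(i <- r | P i) f (F i).
Proof. by move=> lf; rewrite (lin_sum _ _ _ lf). Qed.

Lemma bilin_for V W U (F : V -> W -> U) :
  bilin F -> bilinear_for *:%R *:%R F.
Proof. by case=> F1 F2; split=> [w | v] a x y; [exact: F1 | exact: F2]. Qed.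

Lemma tlift_lin V W U (F : V -> W -> U) : bilin F -> lin (tlift F).
Proof. by move/bilin_for => bF a x y; exact: tlift_linearE. Qed.

Lemma tliftE V W U (F : V -> W -> U) v w :
  bilin F -> tlift F (v ⊗ w) = F v w.
Proof. by move/bilin_for => bF; exact: tlift_pureE. Qed.

Lemma lin_tlift V W U X (F : V -> W -> U) (g : X -> (V ⊗ W)%type) :
  bilin F -> lin g -> lin (fun x => tlift F (g x)).
Proof. by move/tlift_lin; exact: lin_comp. Qed.

Lemma lin_tlift_body V W U X (F : X -> V -> W -> U) (t : (V ⊗ W)%type) :
  (forall v w, lin (fun x => F x v w)) -> lin (fun x => tlift (F x) t).
Proof. by move=> lF; exact: lin_bigsum. Qed.

Lemma eq_tlift V W U (F G : V -> W -> U) (t : (V ⊗ W)%type) :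
  (forall v w, F v w = G v w) -> tlift F t = tlift G t.
Proof. by move=> FG; apply: eq_bigr. Qed.

Lemma lin_tliftE V W U X (f : U -> X) (F : V -> W -> U) (t : (V ⊗ W)%type) :
  lin f -> f (tlift F t) = tlift (fun v w => f (F v w)) t.
Proof. exact: lin_sum. Qed.

Lemma tlift_id V W (t : (V ⊗ W)%type) : tlift (fun v w => v ⊗ w) t = t.
Proof.
rewrite {1}/tlift; have [s def_t] := tensor_sum t.
apply: tlift_inj => U b.
have lb : lin (tlift b) by move=> a x y; exact: tlift_linear.
rewrite (lin_sum _ _ _ lb).
by apply: eq_bigr => x _; rewrite tlift_pure.
Qed.

Lemma tlift_tlift V W V' W' U (G : V' -> W' -> U) (f : V -> W -> V')
    (g : V -> W -> W') (t : (V ⊗ W)%type) : bilin G ->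
  tlift G (tlift (fun v w => f v w ⊗ g v w) t) =
    tlift (fun v w => G (f v w) (g v w)) t.
Proof.
move=> bG; rewrite (lin_tliftE _ _ (tlift_lin bG)).
by apply: eq_tlift => v w; rewrite tliftE.
Qed.

Lemma tlift_sum V W U I (r : seq I) (f : I -> V) (g : I -> W) (F : V -> W -> U) :
  bilin F -> tlift F (\sum_(i <- r) f i ⊗ g i) = \sum_(i <- r) F (f i) (g i).
Proof.
move=> bF; rewrite (lin_sum _ _ _ (tlift_lin bF)).
by apply: eq_bigr => i _; rewrite tliftE.
Qed.

Lemma exchange_tlift V W V' W' U (F : V -> W -> V' -> W' -> U)
    (s : (V ⊗ W)%type) (t : (V' ⊗ W')%type) :
  tlift (fun a b => tlift (fun c d => F a b c d) t) s =
  tlift (fun c d => tlift (fun a b => F a b c d) s) t.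
Proof. exact: exchange_big. Qed.

End Lin.

(** [linear_tac] proves [lin f] and [bilin F] by recursion on the body of the
    function; the leaves are bundled maps and hypotheses. *)
Ltac linear_leaf :=
  first [exact: lin_linear | exact: lin_scalar
        | match goal with H : _ |- _ => solve [apply: H] end].
Ltac linear_step :=
  lazymatch goal with
  | |- bilin _ => first [assumption | split => ? /=]
  | |- lin (fun x => x) => exact: lin_id
  | |- lin (fun _ => tlift _ _) =>
      first [apply: lin_tlift | apply: lin_tlift_body => ? ?]
  | |- lin (fun _ => _ + _) => apply: lin_add
  | |- lin (fun _ => - _) => apply: lin_opp
  | |- lin (fun _ => _ ⊗ _) => first [apply: lin_purel | apply: lin_purer]
  | |- lin (fun _ => _ *: _) => first [apply: lin_scalel | apply: lin_scaler]
  | |- lin (fun _ => \big[_/_]_(_ <- _ | _) _) => apply: lin_bigsum => ?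
  | |- lin (fun _ => _ * _) =>
      first [apply: lin_mull | apply: lin_mulr
            |apply: lin_kmull | apply: lin_kmulr]
  | |- lin (GRing.mul ?c) => apply: (lin_mulr c (@lin_id _ _))
  | |- lin (GRing.scale ?a) => apply: (lin_scaler a (@lin_id _ _))
  | |- lin (pure ?v) => apply: (lin_purer v (@lin_id _ _))
  | |- lin (tlift ?F) => first [apply: tlift_lin | linear_leaf]
  | |- @lin ?k ?V ?U (fun x => ?f _) =>
      first [linear_leaf
            | apply: (@lin_comp k V _ U f); first try linear_leaf
            | lazymatch goal with |- lin (fun x => ?F (@?g x) ?c) =>
                lazymatch g with (fun x => x) => fail | _ => idtac end;
                apply: (@lin_comp k V _ U (fun z => F z c) g); first try linear_leaf
              end]
  | |- lin _ => linear_leaf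
  end.
Ltac linear_tac := repeat linear_step.
(** * Subspaces, complements and finite-dimensional spans *)

Section Subspaces.
Context (k : fieldType).
Implicit Types V W U : lmodType k.

Lemma sub0 V (N : set V) : subspace N -> N 0.
Proof. by case. Qed.

Lemma subD V (N : set V) u v : subspace N -> N u -> N v -> N (u + v).
Proof. by case=> _ NP Nu Nv; rewrite -[u]scale1r; exact: NP. Qed.

Lemma subZ V (N : set V) a u : subspace N -> N u -> N (a *: u).
Proof. by case=> N0 NP Nu; rewrite -[_ *: _]addr0; exact: NP. Qed.

Lemma subB V (N : set V) u v : subspace N -> N u -> N v -> N (u - v).
Proof. by move=> sN Nu Nv; rewrite -scaleN1r; apply: subD => //; exact: subZ. Qed.

Lemma sub_sum V (N : set V) I (r : seq I) (P : pred I) (F : I -> V) :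
  subspace N -> (forall i, P i -> N (F i)) -> N (\sum_(i <- r | P i) F i).
Proof. by move=> sN NF; apply: big_ind => //; [exact: sub0 | move=> *; exact: subD]. Qed.

Lemma sub_tlift V W U (N : set U) (F : V -> W -> U) (t : (V ⊗ W)%type) :
  subspace N -> (forall v w, N (F v w)) -> N (tlift F t).
Proof. by move=> sN NF; exact: sub_sum. Qed.

Lemma subspace_ker V U (f : V -> U) : lin f -> subspace [set v | f v = 0].
Proof.
move=> lf; split=> /= [|a u v fu fv]; first exact: lin0.
by rewrite lf fu fv scaler0 addr0.
Qed.

Lemma subspace_im V U (f : V -> U) (N : set V) :
  lin f -> subspace N -> subspace [set y | exists2 x, N x & y = f x].
Proof.
move=> lf sN; split=> /= [|a _ _ [x Nx ->] [y Ny ->]].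
  by exists 0; [exact: sub0 | rewrite lin0].
by exists (a *: x + y); [apply: subD => //; exact: subZ | rewrite lf].
Qed.

Lemma subspace_line V (v : V) : subspace [set x | exists a : k, x = a *: v].
Proof.
split=> /= [|a _ _ [b ->] [c ->]]; first by exists 0; rewrite scale0r.
by exists (a * b + c); rewrite scalerDl scalerA.
Qed.

(** A maximal subset closed under linear combinations and meeting [N] at most
    in [0] is a complement of [N]; the empty set is allowed so that unions of
    chains need no special case. *)
Lemma lin_projection V (N : set V) : subspace N ->
  exists2 q : V -> V, lin q & (forall v, N (q v)) /\ (forall n, N n -> q n = n).
Proof.
move=> sN.
pose P (X : set V) := (forall (a : k) u v, X u -> X v -> X (a *: u + v)) /\
                      (forall x, X x -> N x -> x = 0).
have [F FP totF|X [[XP XN] maxX]] := @Zorn_bigcup V P.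
  split=> [a u v [Y FY Yu] [Z FZ Zv]|x [Y FY Yx]]; last exact: (FP Y FY).2.
  have [YZ|ZY] := totF Y Z FY FZ.
    by exists Z => //; apply: (FP Z FZ).1 => //; exact: YZ.
  by exists Y => //; apply: (FP Y FY).1 => //; exact: ZY.
have X0 : X 0.
  apply: contrapT => nX0.
  apply: (maxX [set x | x = 0 \/ X x]).
    by split=> [x Xx|/(_ 0 (or_introl erefl))//]; right.
  split=> [a u v [->|Xu] [->|Xv]|x [->|Xx] Nx] //=.
  - by left; rewrite scaler0 addr0.
  - by right; rewrite scaler0 add0r.
  - by case: nX0; rewrite -[0](subrr u) addrC -scaleN1r; exact: XP.
  - by right; exact: XP.
  - exact: XN.
have sX : subspace X by [].
have dec v : exists n, N n /\ X (v - n).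
  apply: contrapT => /forallNP nv.
  pose Y := [set x | exists (a : k) y, X y /\ x = a *: v + y].
  have XY : X `<=` Y by move=> x Xx; exists 0, x; rewrite scale0r add0r.
  have Yv : Y v by exists 1, 0; rewrite scale1r addr0.
  apply: (maxX Y); first (split=> // /(_ v Yv) Xv).
    by apply: (nv 0); split; [exact: sub0 | rewrite subr0].
  split=> [a _ _ [b [y [Xy ->]]] [c [z [Xz ->]]]|x [a [y [Xy ->]]] Nx].
    exists (a * b + c), (a *: y + z); split; first exact: XP.
    by rewrite scalerDr scalerA scalerDl addrACA.
  have [a0|a0] := eqVneq a 0.
    by move: Nx; rewrite a0 scale0r add0r => /XN; exact.
  case: (nv (a^-1 *: (a *: v + y))); split; first exact: subZ.
  rewrite scalerDr scalerA mulVf // scale1r opprD addrA subrr sub0r.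
  by rewrite -scalerN; apply: subZ => //; rewrite -scaleN1r; exact: subZ.
have uniqn v n n' : N n -> X (v - n) -> N n' -> X (v - n') -> n = n'.
  move=> Nn Xn Nn' Xn'; apply/eqP; rewrite -subr_eq0; apply/eqP/XN; last exact: subB.
  suff -> : n - n' = (v - n') - (v - n) by exact: subB.
  by rewrite opprB [RHS]addrC subrKA.
have [q qP] := choice dec.
exists q.
  move=> a u v; have [Nu Xu] := qP u; have [Nv Xv] := qP v.
  have [Nuv Xuv] := qP (a *: u + v).
  apply: (uniqn _ _ _ Nuv Xuv); first by apply: subD => //; exact: subZ.
  suff -> : a *: u + v - (a *: q u + q v) = a *: (u - q u) + (v - q v) by exact: XP.
  by rewrite scalerBr opprD addrACA.
split=> [v|n Nn]; first by have [] := qP v.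
by have [Nq Xq] := qP n; apply: (uniqn _ _ _ Nq Xq Nn); rewrite subrr.
Qed.

Lemma separate V (N : set V) v : subspace N -> ~ N v ->
  exists2 f : V -> k, linf f & (forall n, N n -> f n = 0) /\ f v = 1.
Proof.
move=> sN Nv; have [q lq [qN qid]] := lin_projection sN.
pose u := v - q v.
have u0 : u != 0.
  by apply/eqP => /eqP; rewrite subr_eq0 => /eqP vq; apply: Nv; rewrite vq.
have [r lr [rL rid]] := lin_projection (subspace_line u).
have {rL} /choice [f fP] : forall x, exists a : k, r x = a *: u by exact: rL.
have lf : linf f.
  move=> a x y; apply/eqP; rewrite -subr_eq0; apply/eqP.
  have : (f (a *: x + y) - (a * f x + f y)) *: u = 0.
    by rewrite scalerBl -fP lr scalerDl -scalerA -!fP subrr.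
  by move/eqP; rewrite scaler_eq0 (negPf u0) orbF => /eqP.
exists (fun x => f (x - q x)); first by apply: lin_comp => //; apply: lin_add => //; exact: lin_opp.
split=> /= [n Nn|]; first by rewrite qid // subrr (lin0 lf).
have : f u *: u = 1 *: u by rewrite -fP rid ?scale1r //; exists 1; rewrite scale1r.
move/eqP; rewrite -subr_eq0 -scalerBl scaler_eq0 (negPf u0) orbF subr_eq0.
by move/eqP.
Qed.

Lemma injective_has_retraction V U (f : V -> U) :
  lin f -> (forall x, f x = 0 -> x = 0) ->
  exists2 g : U -> V, lin g & cancel f g.
Proof.
move=> lf f0.
have fI : injective f.
  by move=> x y e; apply/eqP; rewrite -subr_eq0; apply/eqP/f0; rewrite linB // e subrr.
have sT : subspace [set: V] by [].
have [q lq [qI qid]] := lin_projection (subspace_im lf sT).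
have /choice [g gP] : forall y, exists x, q y = f x.
  by move=> y; have [x _] := qI y; exists x.
exists g; first by move=> a x y; apply: fI; rewrite lf -!gP lq.
by move=> x; apply: fI; rewrite -gP qid //; exists x.
Qed.

Definition span V (I : finType) (w : I -> V) : set V :=
  [set x | exists c : I -> k, x = \sum_i c i *: w i].

Definition free V (I : finType) (w : I -> V) : Prop :=
  forall c : I -> k, \sum_i c i *: w i = 0 -> forall i, c i = 0.

Lemma span_subspace V (I : finType) (w : I -> V) : subspace (span w).
Proof.
split=> [|a _ _ [c ->] [d ->]].
  by exists (fun=> 0); rewrite big1 // => i _; rewrite scale0r.
exists (fun i => a * c i + d i); rewrite scaler_sumr -big_split.
by apply: eq_bigr => i _; rewrite scalerDl scalerA.
Qed.

Lemma mem_span V (I : finType) (w : I -> V) i : span w (w i).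
Proof.
exists (fun j => (j == i)%:R); rewrite (bigD1 i) //= eqxx scale1r big1 ?addr0 //.
by move=> j /negPf ->; rewrite scale0r.
Qed.

Lemma span_min V (I : finType) (w : I -> V) (N : set V) :
  subspace N -> (forall i, N (w i)) -> span w `<=` N.
Proof. by move=> sN Nw _ [c ->]; apply: sub_sum => // i _; exact: subZ. Qed.

Lemma free_dual V (I : finType) (w : I -> V) : free w ->
  exists2 f : I -> V -> k, (forall i, linf (f i)) &
    forall i j, f i (w j) = (i == j)%:R.
Proof.
move=> fw.
have fP i : exists f : V -> k, linf f /\ forall j, f (w j) = (i == j)%:R.
  pose N := [set x | exists c : I -> k, x = \sum_(j | j != i) c j *: w j].
  have sN : subspace N.
    split=> [|a _ _ [c ->] [d ->]].
      by exists (fun=> 0); rewrite big1 // => j _; rewrite scale0r.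
    exists (fun j => a * c j + d j); rewrite scaler_sumr -big_split.
    by apply: eq_bigr => j _; rewrite scalerDl scalerA.
  have Nwi : ~ N (w i).
    move=> [c wi]; pose d j := if j == i then -1 else c j.
    have : \sum_j d j *: w j = 0.
      rewrite (bigD1 i) //= /d eqxx scaleN1r [w i in X in X + _]wi addrC; apply/eqP.
      rewrite subr_eq0; apply/eqP; apply: eq_bigr => j /negPf ji.
      by rewrite ji.
    by move/fw/(_ i)/eqP; rewrite /d eqxx oppr_eq0 oner_eq0.
  have [f lf [fN fi]] := separate sN Nwi; exists f; split=> // j.
  have [<-//|ij] := eqVneq i j; apply: fN.
  exists (fun l => (l == j)%:R); rewrite (bigD1 j) 1?eq_sym //= eqxx scale1r.
  by rewrite big1 ?addr0 // => l /andP [_ /negPf ->]; rewrite scale0r.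
have [f fP'] := choice fP.
by exists f => [i|i j]; [exact: (fP' i).1 | exact: (fP' i).2].
Qed.

Lemma dual_free V (I : finType) (w : I -> V) (f : I -> V -> k) :
  (forall i, linf (f i)) -> (forall i j, f i (w j) = (i == j)%:R) -> free w.
Proof.
move=> lf fw c cw i; have := linf0 (lf i); rewrite -cw (linf_sum _ _ _ (lf i)).
rewrite (bigD1 i) //= linfZ // fw eqxx mulr1 big1 ?addr0 // => j ji.
by rewrite linfZ // fw eq_sym (negPf ji) mulr0.
Qed.

Lemma span_coord V (I : finType) (w : I -> V) (f : I -> V -> k) x :
  (forall i, linf (f i)) -> (forall i j, f i (w j) = (i == j)%:R) -> span w x ->
  x = \sum_i f i x *: w i.
Proof.
move=> lf fw [c ->]; apply: eq_bigr => i _; congr (_ *: _).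
rewrite (linf_sum _ _ _ (lf i)) (bigD1 i) //= linfZ // fw eqxx mulr1.
by rewrite big1 ?addr0 // => j ji; rewrite linfZ // fw eq_sym (negPf ji) mulr0.
Qed.

Lemma span_drop V n (w : 'I_n.+1 -> V) (c : 'I_n.+1 -> k) i :
  \sum_j c j *: w j = 0 -> c i != 0 -> span w = span (w \o lift i).
Proof.
move=> cw ci; apply/seteqP; split; last first.
  by apply: span_min; [exact: span_subspace | move=> j; exact: mem_span].
apply: span_min; first exact: span_subspace.
move=> j; case: (unliftP i j) => [l ->|->].
  exact: (mem_span (w \o lift i) l).
exists (fun l => - (c i)^-1 * c (lift i l)).
apply: (scalerI ci); rewrite scaler_sumr; apply/eqP; rewrite -subr_eq0; apply/eqP.
rewrite -[RHS]cw (bigD1_ord i) //= -sumrN; congr (_ + _).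
apply: eq_bigr => l _; rewrite scalerA mulrA mulrN mulfV // mulN1r scaleNr.
by rewrite opprK.
Qed.

Definition spanned V n (N : set V) : Prop := exists w : 'I_n -> V, N = span w.

Lemma spanned_basis V n (N : set V) : spanned n N ->
  exists m (w : 'I_m -> V), [/\ (m <= n)%N, N = span w & free w].
Proof.
elim: n => [|n IHn] [w Nw]; first by exists 0, w; split=> // c _ [].
have [fw|] := pselect (free w); first by exists n.+1, w.
move=> /existsNP [c /not_implyP [cw /existsNP [i /eqP ci]]].
have [|m [v [mn Nv fv]]] := IHn.
  by exists (w \o lift i); rewrite -(span_drop cw ci).
by exists m, v; split=> //; exact: leq_trans mn _.
Qed.

Lemma sub_spanned V n (N N' : set V) : subspace N' -> spanned n N -> N' `<=` N ->
  exists2 m, (m <= n)%N & spanned m N'.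
Proof.
elim: n N N' => [|n IHn] N N' sN' [w ->] NN'.
  exists 0%N => //; exists w; apply/seteqP; split=> // _ [c ->].
  by rewrite big_ord0; exact: sub0.
pose M := [set x | N' x /\ span (w \o lift ord0) x].
have sM : subspace M.
  split=> [|a u v [Nu Mu] [Nv Mv]]; first by split; apply: sub0 => //; exact: span_subspace.
  by split; apply: subD => //; try exact: span_subspace; apply: subZ => //; exact: span_subspace.
have [||m mn [v Mv]] := IHn (span (w \o lift ord0)) M sM; first by exists (w \o lift ord0).
  by move=> x [].
have [N'M|] := pselect (N' `<=` M).
  exists m; first exact: leq_trans mn _.
  by exists v; rewrite -Mv; apply/seteqP; split=> // x [].
move=> /existsNP [x /not_implyP [Nx Mx]].
have [c def_x] := NN' _ Nx.
have c0 : c ord0 != 0.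
  apply/eqP => c0; apply: Mx; split=> //; exists (c \o lift ord0).
  by rewrite def_x big_ord_recl c0 scale0r add0r.
exists m.+1 => //; exists (fun i => if unlift ord0 i is Some j then v j else x).
apply/seteqP; split=> [y Ny|].
  have [d def_y] := NN' _ Ny; pose a := d ord0 / c ord0.
  have : M (y - a *: x).
    split; first by apply: subB => //; exact: subZ.
    exists (fun j => d (lift ord0 j) - a * c (lift ord0 j)).
    rewrite def_y def_x !big_ord_recl scalerDr scalerA divfK // opprD addrACA subrr add0r.
    rewrite scaler_sumr -sumrB; apply: eq_bigr => j _ /=.
    by rewrite scalerBl scalerA.
  rewrite Mv => -[e ye]; exists (fun i => if unlift ord0 i is Some j then e j else a).
  rewrite big_ord_recl unlift_none.
  under eq_bigr => i _ do rewrite liftK.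
  by rewrite -ye addrC subrK.
apply: span_min => // i; case: unliftP => [j _|_] //.
by have : span v (v j) by [exact: mem_span]; rewrite -Mv => -[].
Qed.

Lemma sub_spanned_lt V n (N N' : set V) : subspace N' -> spanned n N ->
  N' `<=` N -> N' <> N -> exists2 m, (m < n)%N & spanned m N'.
Proof.
move=> sN' [w ->] NN' neq.
have [x [Nx N'x]] : exists x, span w x /\ ~ N' x.
  apply: contrapT => /forallNP H; apply: neq; apply/seteqP; split=> // x Nx.
  by apply: contrapT => N'x; apply: (H x).
have [g lg [gN' gx]] := separate sN' N'x.
have [i gi] : exists i, g (w i) != 0.
  apply: contrapT => /forallNP H; have [c def_x] := Nx.
  have /eqP := gx; rewrite def_x (linf_sum _ _ _ lg) big1 ?(eq_sym 0) ?oner_eq0 // => i _.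
  rewrite linfZ //; have [->|//] := eqVneq (g (w i)) 0; first by rewrite mulr0.
  by move=> gi; case: (H i).
case: n w NN' neq Nx i gi => [|n] w NN' neq Nx i gi; first by case: i gi.
pose v j := w (lift i j) - (g (w (lift i j)) / g (w i)) *: w i.
suff N'v : N' `<=` span v.
  by apply: (@sub_spanned _ _ (span v)) => //; exists v.
move=> y N'y; have [c def_y] := NN' _ N'y.
exists (c \o lift i).
have := gN' _ N'y; rewrite def_y (linf_sum _ _ _ lg) (bigD1_ord i) //= => gy.
rewrite (bigD1_ord i) //= /v.
under [RHS]eq_bigr => j _ do rewrite scalerBr scalerA.
rewrite sumrB addrC; congr (_ + _).
rewrite -scaler_suml -scaleNr; congr (_ *: _).
apply: (mulIf gi); rewrite mulNr mulr_suml.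
under eq_bigr => j _ do rewrite mulrA divfK // -linfZ //.
move/eqP: gy; rewrite addr_eq0 => /eqP gy.
by rewrite -[RHS]gy linfZ.
Qed.

End Subspaces.

(** * Tensors over a field *)

(** Sweedler sums. The body has to be bilinear for the value not to depend on the
    representative of [t] that is summed over. *)
Notation "\sw_ ( a , b <- t ) E" := (tlift (fun a b => E) t)
  (at level 41, a name, b name, t at level 60, E at level 41,
   format "'[' \sw_ ( a ,  b  <-  t ) '/  '  E ']'") : ring_scope.

Section Tensors.
Context (k : fieldType).
Implicit Types V W U : lmodType k.

Lemma tensor_free V W (t : (V ⊗ W)%type) :
  exists n (v : 'I_n -> V) (w : 'I_n -> W),
    t = \sum_i v i ⊗ w i /\ free w.
Proof.
have [n [v [w ->]]] : exists n (v : 'I_n -> V) (w : 'I_n -> W),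
    t = \sum_i v i ⊗ w i.
  have [s ->] := tensor_sum t.
  exists (size s), (fun i => (tnth (in_tuple s) i).1), (fun i => (tnth (in_tuple s) i).2).
  by rewrite big_tnth.
elim: n v w => [|n IHn] v w; first by exists 0%N, v, w; split=> // c _ [].
have [fw|] := pselect (free w); first by exists n.+1, v, w.
move=> /existsNP [c /not_implyP [cw /existsNP [i /eqP ci]]].
have [d def_wi] : span (w \o lift i) (w i).
  by rewrite -(span_drop cw ci); exact: mem_span.
suff -> : \sum_i v i ⊗ w i =
    \sum_j (v (lift i j) + d j *: v i) ⊗ (w \o lift i) j by exact: IHn.
rewrite (bigD1_ord i) //= def_wi linear_sumr /= -big_split /=.
by apply: eq_bigr => j _; rewrite linearZr_LR linearDl linearZl_LR /= addrC.
Qed.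

(** In an expression of [t] with free second legs, contraction with the dual
    functionals isolates each first leg. *)
Lemma tensor_sepr V W (t : (V ⊗ W)%type) :
  (forall f : W -> k, linf f -> \sw_(v, w <- t) f w *: v = 0) -> t = 0.
Proof.
move=> t0; have [n [v [w [def_t /free_dual [f lf fw]]]]] := tensor_free t.
rewrite def_t big1 // => i _; suff -> : v i = 0 by rewrite linear0l.
have := t0 _ (lf i); rewrite def_t tlift_sum; last by linear_tac.
rewrite (bigD1 i) //= fw eqxx scale1r big1 ?addr0 // => j ji.
by rewrite fw eq_sym (negPf ji) scale0r.
Qed.

Lemma tensor_eqr V W (t u : (V ⊗ W)%type) :
  (forall f : W -> k, linf f ->
    \sw_(v, w <- t) f w *: v = \sw_(v, w <- u) f w *: v) -> t = u.
Proof.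
move=> tu; apply/eqP; rewrite -subr_eq0; apply/eqP/tensor_sepr => f lf.
rewrite (linB (_ : lin (tlift _))) ?tu ?subrr //.
by apply: tlift_lin; linear_tac.
Qed.

Definition tflip V W (t : (V ⊗ W)%type) : (W ⊗ V)%type := \sw_(v, w <- t) w ⊗ v.

Lemma tflip_lin V W : lin (@tflip V W).
Proof. by apply: tlift_lin; linear_tac. Qed.

Lemma tlift_flip V W U (F : W -> V -> U) (t : (V ⊗ W)%type) : bilin F ->
  tlift F (tflip t) = \sw_(v, w <- t) F w v.
Proof. by move=> bF; rewrite tlift_tlift. Qed.

Lemma tflipK V W : cancel (@tflip V W) (@tflip W V).
Proof. by move=> t; rewrite {1}/tflip tlift_flip ?tlift_id //; linear_tac. Qed.

Lemma tensor_eql V W (t u : (V ⊗ W)%type) :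
  (forall f : V -> k, linf f ->
    \sw_(v, w <- t) f v *: w = \sw_(v, w <- u) f v *: w) -> t = u.
Proof.
move=> tu; apply: (can_inj (@tflipK V W)); apply: tensor_eqr => f lf.
by rewrite !tlift_flip ?tu //; linear_tac.
Qed.

Lemma tens_sub_pure V W (N : set V) (P : set W) v w :
  N v -> P w -> tens_sub N P (v ⊗ w).
Proof.
by move=> Nv Pw; exists [:: (v, w)]; [move=> x; rewrite inE => /eqP -> | rewrite big_seq1].
Qed.

Lemma tens_sub_subspace V W (N : set V) (P : set W) :
  subspace N -> subspace (tens_sub N P).
Proof.
move=> sN; split=> [|a _ _ [s sNP ->] [t tNP ->]]; first by exists [::]; rewrite ?big_nil.
exists ([seq (a *: x.1, x.2) | x <- s] ++ t).
  move=> x; rewrite mem_cat => /orP [/mapP [y ys ->]|/tNP //].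
  by have [Ny Py] := sNP y ys; split=> //=; exact: subZ.
rewrite big_cat big_map scaler_sumr /=; congr (_ + _).
by apply: eq_bigr => x _; rewrite linearZl_LR.
Qed.

Lemma tens_sub_tlift V W U (N : set V) (P : set W) (Q : set U) (F : V -> W -> U) t :
  bilin F -> subspace Q -> (forall v w, N v -> P w -> Q (F v w)) ->
  tens_sub N P t -> Q (tlift F t).
Proof.
move=> bF sQ QF [s sNP ->]; rewrite tlift_sum // big_seq.
by apply: sub_sum => // x xs; have [] := sNP x xs; exact: QF.
Qed.

Lemma tens_sub_contract V W (N : set V) (P : set W) (f : W -> k) t :
  subspace N -> linf f -> tens_sub N P t -> N (\sw_(v, w <- t) f w *: v).
Proof.
move=> sN lf; apply: tens_sub_tlift => //; first by linear_tac.
by move=> v w Nv _; exact: subZ.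
Qed.

(** A projection onto [N] applied to the first leg changes no contraction of
    [t], hence fixes [t]. *)
Lemma tens_sub_of_contract V W (N : set V) (t : (V ⊗ W)%type) : subspace N ->
  (forall f : W -> k, linf f -> N (\sw_(v, w <- t) f w *: v)) ->
  tens_sub N setT t.
Proof.
move=> sN Nt; have [q lq [qN qid]] := lin_projection sN.
have -> : t = \sw_(v, w <- t) q v ⊗ w.
  apply: tensor_eqr => f lf; rewrite tlift_tlift; last by linear_tac.
  rewrite -[LHS]qid ?lin_tliftE; try exact: Nt; try by [].
  by apply: eq_tlift => v w; rewrite linZ.
apply: sub_tlift; first exact: tens_sub_subspace.
by move=> v w; exact: tens_sub_pure.
Qed.

Lemma tensor_map_inj V W V' W' (f : V -> V') (g : W -> W') (t : (V ⊗ W)%type) :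
  lin f -> lin g -> (forall v, f v = 0 -> v = 0) -> (forall w, g w = 0 -> w = 0) ->
  \sw_(v, w <- t) f v ⊗ g w = 0 -> t = 0.
Proof.
move=> lf lg f0 g0 t0.
have [f' lf' fK] := injective_has_retraction lf f0.
have [g' lg' gK] := injective_has_retraction lg g0.
rewrite -[LHS]tlift_id -(lin0 (@tlift_lin _ _ _ _ (fun v w => f' v ⊗ g' w) _)) -?t0;
  last by linear_tac.
rewrite tlift_tlift; last by linear_tac.
by apply: eq_tlift => v w; rewrite fK gK.
Qed.

End Tensors.

(** * Comodules and the action of functionals *)

Definition trilin (k : fieldType) (U V W X : lmodType k) (F : U -> V -> W -> X) :=
  [/\ forall v w, lin (fun u => F u v w), forall u w, lin (fun v => F u v w)
    & forall u v, lin (F u v)].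

Ltac trilinear_tac := split => ? ? /=; linear_tac.

Section Comodules.
Context (k : fieldType).
Implicit Types U V W X : lmodType k.

Lemma tassoc_tmap U V W X (f : U -> (V ⊗ W)%type) (t : (U ⊗ X)%type) :
  lin f -> tassoc (tmap f idfun t) =
    \sw_(u, x <- t) \sw_(v, w <- f u) v ⊗ (w ⊗ x).
Proof.
move=> lf; rewrite /tassoc /tlift3 /tmap tlift_tlift; last by linear_tac.
by [].
Qed.

Lemma tmap_sum U V W X (g : X -> (V ⊗ W)%type) (t : (U ⊗ X)%type) :
  lin g -> tmap idfun g t = \sw_(u, x <- t) \sw_(v, w <- g x) u ⊗ (v ⊗ w).
Proof.
move=> lg; apply: eq_tlift => u x.
rewrite -[g x in LHS]tlift_id (lin_tliftE _ _ (_ : lin (fun y => u ⊗ y))) //.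
by linear_tac.
Qed.

Lemma trilin_assoc U V W X (F : U -> V -> W -> X) u v w : trilin F ->
  \sw_(a, t <- u ⊗ (v ⊗ w)) \sw_(b, c <- t) F a b c = F u v w.
Proof.
by move=> [F1 F2 F3]; rewrite !tliftE //; linear_tac.
Qed.

Lemma trilin_assoc_lin U V W X (F : U -> V -> W -> X) : trilin F ->
  lin (fun s : (U ⊗ (V ⊗ W))%type => \sw_(a, t <- s) \sw_(b, c <- t) F a b c).
Proof. by move=> [F1 F2 F3]; linear_tac. Qed.

Lemma assoc_sum U V W X (Y Z : lmodType k) (f : U -> (V ⊗ W)%type) (g : Y -> (W ⊗ X)%type)
    (F : V -> W -> X -> Z) (s : (U ⊗ X)%type) (t : (V ⊗ Y)%type) :
  trilin F -> lin f -> lin g -> tassoc (tmap f idfun s) = tmap idfun g t ->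
  \sw_(u, x <- s) \sw_(v, w <- f u) F v w x = \sw_(v, y <- t) \sw_(w, x <- g y) F v w x.
Proof.
move=> tF lf lg; rewrite tassoc_tmap // tmap_sum // => e.
have lL := trilin_assoc_lin tF.
have := congr1 (fun s => \sw_(a, t <- s) \sw_(b, c <- t) F a b c) e.
rewrite !(lin_tliftE _ _ lL).
under eq_tlift => u x do rewrite (lin_tliftE _ _ lL).
under [RHS]eq_tlift => v y do rewrite (lin_tliftE _ _ lL).
under eq_tlift => u x do under eq_tlift => v w do rewrite trilin_assoc //.
by under [RHS]eq_tlift => v y do under eq_tlift => w x do rewrite trilin_assoc //.
Qed.

Section Right.
Context (C : coalgType k) (M : lmodType k) (rho : {linear M -> (M ⊗ C)%type}).

Lemma coact_sum (X : lmodType k) (F : M -> C -> C -> X) m :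
  right_comodule rho -> trilin F ->
  \sw_(n, c <- rho m) \sw_(n1, c1 <- rho n) F n1 c1 c =
  \sw_(n, c <- rho m) \sw_(c1, c2 <- comul c) F n c1 c2.
Proof.
by move=> [rA _] tF; apply: assoc_sum (rA m) => //; exact: lin_linear.
Qed.

Lemma coact_counit m : right_comodule rho ->
  \sw_(n, c <- rho m) (counit c *: n) = m.
Proof. by case. Qed.

Lemma coact_counitE (X : lmodType k) (f : M -> X) m : right_comodule rho -> lin f ->
  \sw_(n, c <- rho m) (counit c *: f n) = f m.
Proof.
move=> rM lf; rewrite -[in RHS](coact_counit m rM) (lin_tliftE _ _ lf).
by apply: eq_tlift => n c; rewrite linZ.
Qed.

Lemma right_comodule_intro :
  (forall m, \sw_(n, c <- rho m) \sw_(n1, c1 <- rho n) n1 ⊗ (c1 ⊗ c) =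
             \sw_(n, c <- rho m) \sw_(c1, c2 <- comul c) n ⊗ (c1 ⊗ c2)) ->
  (forall m, \sw_(n, c <- rho m) (counit c *: n) = m) -> right_comodule rho.
Proof.
move=> rA rC; split=> // m.
by rewrite tassoc_tmap ?rA ?tmap_sum //; exact: lin_linear.
Qed.

End Right.

Section Left.
Context (C : coalgType k) (M : lmodType k) (rho : {linear M -> (C ⊗ M)%type}).

Lemma coact_suml (X : lmodType k) (F : C -> C -> M -> X) m :
  left_comodule rho -> trilin F ->
  \sw_(c, n <- rho m) \sw_(c1, c2 <- comul c) F c1 c2 n =
  \sw_(c, n <- rho m) \sw_(c1, n1 <- rho n) F c c1 n1.
Proof.
by move=> [rA _] tF; apply: assoc_sum (rA m) => //; exact: lin_linear.
Qed.

Lemma left_comodule_intro :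
  (forall m, \sw_(c, n <- rho m) \sw_(c1, c2 <- comul c) c1 ⊗ (c2 ⊗ n) =
             \sw_(c, n <- rho m) \sw_(c1, n1 <- rho n) c ⊗ (c1 ⊗ n1)) ->
  (forall m, \sw_(c, n <- rho m) (counit c *: n) = m) -> left_comodule rho.
Proof.
move=> rA rC; split=> // m.
by rewrite tassoc_tmap ?rA ?tmap_sum //; exact: lin_linear.
Qed.

End Left.

Lemma comul_comodule (C : coalgType k) : right_comodule (@comul k C).
Proof. by split=> x; [exact: comulA | exact: comul_counitr]. Qed.

Lemma coassoc (C : coalgType k) X (F : C -> C -> C -> X) x : trilin F ->
  \sw_(a, b <- comul x) \sw_(a1, a2 <- comul a) F a1 a2 b =
  \sw_(a, b <- comul x) \sw_(b1, b2 <- comul b) F a b1 b2.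
Proof. by move=> tF; apply: coact_sum => //; exact: comul_comodule. Qed.

Lemma counitl (C : coalgType k) X (f : C -> X) x : lin f ->
  \sw_(a, b <- comul x) (counit a *: f b) = f x.
Proof.
move=> lf; rewrite -[in RHS](comul_counitl x) (lin_tliftE _ _ lf).
by apply: eq_tlift => a b; rewrite linZ.
Qed.

Lemma counitr (C : coalgType k) X (f : C -> X) x : lin f ->
  \sw_(a, b <- comul x) (counit b *: f a) = f x.
Proof. by move=> lf; apply: coact_counitE => //; exact: comul_comodule. Qed.

End Comodules.

(** Functionals on a coalgebra form an algebra under convolution. It acts on the
    left on every right comodule by [act], and subcomodules are the subspaces
    stable under this action. *)
Definition conv (k : fieldType) (C : coalgType k) (f g : C -> k) (x : C) : k :=
  \sw_(a, b <- comul x) (f a * g b : k^o).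

Definition act (k : fieldType) (C : coalgType k) (M : lmodType k)
    (rho : M -> (M ⊗ C)%type) (f : C -> k) (m : M) : M :=
  \sw_(n, c <- rho m) (f c *: n).

Section Action.
Context (k : fieldType) (C : coalgType k).

Lemma conv_lin (f g : C -> k) : linf f -> linf g -> linf (conv f g).
Proof. by move=> lf lg; rewrite /conv; linear_tac. Qed.

Context (M : lmodType k) (rho : {linear M -> (M ⊗ C)%type}).
Hypothesis rhoM : right_comodule rho.

Lemma act_lin (f : C -> k) : linf f -> lin (act rho f).
Proof. by move=> lf; rewrite /act; linear_tac. Qed.

Lemma act_counit m : act rho counit m = m.
Proof. exact: coact_counit. Qed.

Lemma act_conv (f g : C -> k) m : linf f -> linf g ->
  act rho f (act rho g m) = act rho (conv f g) m.
Proof.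
move=> lf lg; rewrite [X in act _ _ X]/act (lin_tliftE _ _ (act_lin lf)).
transitivity (\sw_(n, c <- rho m) \sw_(n1, c1 <- rho n) ((f c1 * g c) *: n1)).
  apply: eq_tlift => n c; rewrite linZ; last exact: act_lin.
  rewrite /act (lin_tliftE _ _ (lin_scaler _ (@lin_id _ _))).
  by apply: eq_tlift => n1 c1; rewrite scalerA mulrC.
rewrite (coact_sum (F := fun n1 c1 c => (f c1 * g c) *: n1)) //; last by trilinear_tac.
apply: eq_tlift => n c; rewrite /conv.
by rewrite (lin_tliftE _ _ (lin_scalel n (@lin_id k k^o))).
Qed.

Lemma subcomodule_act (N : set M) :
  right_subcomodule rho N <->
  subspace N /\ forall f, linf f -> forall m, N m -> N (act rho f m).
Proof.
split=> [[sN Nrho]|[sN Nact]]; split=> //.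
  by move=> f lf m /Nrho; exact: tens_sub_contract.
by move=> m Nm; apply: tens_sub_of_contract => // f lf; exact: Nact.
Qed.

Lemma subcomodule_orbit m :
  right_subcomodule rho [set x | exists2 f, linf f & x = act rho f m].
Proof.
apply/subcomodule_act; split.
  split=> [|a _ _ [f lf ->] [g lg ->]].
    exists (fun=> 0); first exact: lin_cst0.
    by rewrite /act /tlift big1 // => i _; rewrite scale0r.
  exists (fun x => a *: f x + g x); first by linear_tac.
  rewrite /act /tlift scaler_sumr -big_split; apply: eq_bigr => i _.
  by rewrite scalerDl scalerA.
move=> f lf _ [g lg ->]; exists (conv f g); first exact: conv_lin.
exact: act_conv.
Qed.

Lemma mem_orbit m : exists2 f, linf f & m = act rho f m.
Proof. by exists counit; [exact: lin_scalar | rewrite act_counit]. Qed.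

(** Local finiteness: the orbit of [m] is spanned by the first legs of any
    expression of [rho m] with free second legs. *)
Lemma orbit_spanned m :
  exists n, spanned n [set x | exists2 f, linf f & x = act rho f m].
Proof.
have [n [v [w [def_m fw]]]] := tensor_free (rho m).
exists n, v; apply/seteqP; split=> [_ [f lf ->]|].
  exists (f \o w); rewrite /act def_m tlift_sum //; by linear_tac.
apply: span_min; first by case: (subcomodule_orbit m).
move=> i; have [f lf fw'] := free_dual fw; exists (f i) => //.
rewrite /act def_m tlift_sum; last by linear_tac.
rewrite (bigD1 i) //= fw' eqxx scale1r big1 ?addr0 // => j ji.
by rewrite fw' eq_sym (negPf ji) scale0r.
Qed.

Lemma minimal_subcomodule n (N : set M) :
  right_subcomodule rho N -> spanned n N -> N <> [set 0] ->
  exists T m, [/\ T `<=` N, spanned m T & simple_for (right_subcomodule rho) T].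
Proof.
have [p] := ubnP n; elim: p n N => // p IHp n N /ltnSE np cN sN N0.
have [simN|] := pselect (forall P, right_subcomodule rho P -> P `<=` N -> P = [set 0] \/ P = N).
  by exists N, n; split=> //; split.
move=> /existsNP [P /not_implyP [cP /not_implyP [PN /not_orP [P0 PN']]]].
have [n' n'n sP] := sub_spanned_lt cP.1 sN PN PN'.
have [T [m [TP sT simT]]] := IHp n' P (leq_trans n'n np) cP sP P0.
by exists T, m; split=> // x /TP /PN.
Qed.

Lemma exists_simple (N : set M) : right_subcomodule rho N -> N <> [set 0] ->
  exists T m, [/\ T `<=` N, spanned m T & simple_for (right_subcomodule rho) T].
Proof.
move=> cN N0; have [m [Nm m0]] : exists m, N m /\ m <> 0.
  apply: contrapT => /forallNP H; apply: N0; apply/seteqP; split=> [x Nx|_ ->].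
    by apply: contrapT => x0; apply: (H x).
  exact: sub0 cN.1.
have [n sO] := orbit_spanned m.
have [|T [l [TO sT simT]]] := minimal_subcomodule (subcomodule_orbit m) sO.
  by move=> /seteqP [/(_ m (mem_orbit m)) /m0].
exists T, l; split=> // x /TO [f lf ->].
by have [_ Nact] := (subcomodule_act N).1 cN; exact: Nact.
Qed.

End Action.

(** * The antipode and integrals *)

Section Antipode.
Context (k : fieldType) (H : hopfAlgType k).
Local Notation S := (@antipode k H).
Implicit Types (x y : H) (X : lmodType k).

Lemma comulM_sum X (F : H -> H -> X) x y : bilin F ->
  tlift F (comul (x * y)) =
  \sw_(a, b <- comul x) \sw_(c, d <- comul y) F (a * c) (b * d).
Proof.
move=> bF; rewrite comulM /tmul (lin_tliftE _ _ (tlift_lin bF)).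
by apply: eq_tlift => a b; rewrite tlift_tlift.
Qed.

Lemma comul1_sum X (F : H -> H -> X) : bilin F -> tlift F (comul (1 : H)) = F 1 1.
Proof. by move=> bF; rewrite comul1 tliftE. Qed.

Lemma antipodelE X (f : H -> X) x : lin f ->
  \sw_(a, b <- comul x) f (S a * b) = counit x *: f 1.
Proof. by move=> lf; rewrite -linZ // -antipodel (lin_tliftE _ _ lf). Qed.

Lemma antipoderE X (f : H -> X) x : lin f ->
  \sw_(a, b <- comul x) f (a * S b) = counit x *: f 1.
Proof. by move=> lf; rewrite -linZ // -antipoder (lin_tliftE _ _ lf). Qed.

Lemma antipode1 : S 1 = 1.
Proof.
have := antipodel (1 : H); rewrite comul1_sum; last by linear_tac.
by rewrite mulr1 counit1 scale1r.
Qed.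

Lemma counit_antipode x : counit (S x) = counit x.
Proof.
have lc : linf (counit : H -> k) by exact: lin_scalar.
have := congr1 (counit : H -> k) (antipodel x).
rewrite (lin_tliftE _ _ lc) (linZ lc) counit1 /GRing.scale /= mulr1 => <-.
rewrite -(counitr (f := fun y => counit (S y) : k^o)); last by linear_tac.
by apply: (@eq_tlift _ _ _ k^o) => a b; rewrite counitM mulrC.
Qed.

Lemma antipodeM x y : S (x * y) = S y * S x.
Proof.
(* S(x y) = S(y1) S(x1) x2 y2 S(x3 y3) = S(y) S(x). *)
transitivity (\sw_(a, b <- comul x) \sw_(c, d <- comul y)
  \sw_(a1, a2 <- comul a) \sw_(c1, c2 <- comul c)
  (S c1 * ((S a1 * a2) * c2) * S (b * d))).
  rewrite -(counitl (f := fun z => S (z * y))); last by linear_tac.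
  apply: eq_tlift => a b.
  rewrite -(counitl (f := fun z => S (b * z))); last by linear_tac.
  rewrite (lin_tliftE _ _ (lin_scaler _ (@lin_id _ _))); apply: eq_tlift => c d.
  rewrite (antipodelE (f := fun z => \sw_(c1, c2 <- comul c) (S c1 * (z * c2) * S (b * d))));
    last by linear_tac.
  congr (_ *: _); under eq_tlift => c1 c2 do rewrite mul1r.
  by rewrite (antipodelE (f := fun z => z * S (b * d))) ?mul1r //; linear_tac.
transitivity (\sw_(a, b <- comul x) \sw_(b1, b2 <- comul b)
  \sw_(c, d <- comul y) \sw_(d1, d2 <- comul d)
  (S c * ((S a * b1) * d1) * S (b2 * d2))).
  under eq_tlift => a b do rewrite exchange_tlift.
  rewrite (coassoc (F := fun a1 a2 b => \sw_(c, d <- comul y) \sw_(c1, c2 <- comul c)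
    (S c1 * ((S a1 * a2) * c2) * S (b * d)))); last by trilinear_tac.
  apply: eq_tlift => a b; apply: eq_tlift => b1 b2.
  by rewrite coassoc //; trilinear_tac.
transitivity (\sw_(a, b <- comul x) \sw_(c, d <- comul y)
   (counit (b * d) *: (S c * S a))).
  apply: eq_tlift => a b; rewrite exchange_tlift; apply: eq_tlift => c d.
  transitivity (\sw_(u, v <- comul (b * d)) (S c * S a * (u * S v))).
    rewrite comulM_sum; last by linear_tac.
    by apply: eq_tlift => b1 b2; apply: eq_tlift => d1 d2; rewrite !mulrA.
  by rewrite (antipoderE (f := fun z => S c * S a * z)) ?mulr1 //; linear_tac.
transitivity (\sw_(a, b <- comul x) (counit b *: (S y * S a))).
  apply: eq_tlift => a b.
  rewrite -(counitr (f := fun z => S z * S a)); last by linear_tac.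
  rewrite (lin_tliftE _ _ (lin_scaler _ (@lin_id _ _))); apply: eq_tlift => c d.
  by rewrite counitM scalerA.
by rewrite (counitr (f := fun z => S y * S z)) //; linear_tac.
Qed.

Lemma comul_antipode X (F : H -> H -> X) x : bilin F ->
  tlift F (comul (S x)) = \sw_(a, b <- comul x) F (S b) (S a).
Proof.
(* Both sides equal F at the product of the coproduct of S(x1), of x2 ⊗ x3 and
   of S(x5) ⊗ S(x4). *)
move=> bF; have [F1 F2] := bF.
have cancel_right (G : H -> H -> X) y : bilin G ->
    \sw_(u, v <- comul y) \sw_(u1, u2 <- comul u) \sw_(v1, v2 <- comul v)
      G (u1 * S v2) (u2 * S v1) = counit y *: G 1 1.
  move=> [G1 G2].
  rewrite (coassoc (F := fun u1 u2 v => \sw_(v1, v2 <- comul v)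
      G (u1 * S v2) (u2 * S v1))); last by trilinear_tac.
  rewrite -(antipoderE (f := fun z => G z 1)) //.
  apply: eq_tlift => u1 w.
  rewrite -(coassoc (F := fun u2 v1 v2 => G (u1 * S v2) (u2 * S v1)));
    last by trilinear_tac.
  rewrite -(counitl (f := fun z => G (u1 * S z) 1)); last by linear_tac.
  apply: eq_tlift => z v2.
  by rewrite (antipoderE (f := fun z => G (u1 * S v2) z)).
transitivity (\sw_(a, b <- comul x) \sw_(s, t <- comul (S a))
  \sw_(u, v <- comul b) \sw_(u1, u2 <- comul u) \sw_(v1, v2 <- comul v)
      F (s * (u1 * S v2)) (t * (u2 * S v1))).
  rewrite -(counitr (f := fun z => tlift F (comul (S z)))); last by linear_tac.
  apply: eq_tlift => a b; rewrite (lin_tliftE _ _ (lin_scaler _ (@lin_id _ _))).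
  apply: eq_tlift => s t.
  by rewrite (cancel_right (fun p q => F (s * p) (t * q))) ?mulr1 //; linear_tac.
under eq_tlift => a b do rewrite exchange_tlift.
rewrite -(coassoc (F := fun a u v => \sw_(s, t <- comul (S a)) \sw_(u1, u2 <- comul u)
   \sw_(v1, v2 <- comul v) F (s * (u1 * S v2)) (t * (u2 * S v1)))); last by trilinear_tac.
rewrite -(counitl (f := fun z => \sw_(a, b <- comul z) F (S b) (S a))); last by linear_tac.
apply: eq_tlift => w v.
transitivity (\sw_(a, u <- comul w) \sw_(s, t <- comul (S a * u))
    \sw_(v1, v2 <- comul v) F (s * S v2) (t * S v1)).
  apply: eq_tlift => a u; rewrite comulM_sum; last by linear_tac.
  apply: eq_tlift => s t; apply: eq_tlift => u1 u2; apply: eq_tlift => v1 v2.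
  by rewrite !mulrA.
rewrite (antipodelE (f := fun z => \sw_(s, t <- comul z) \sw_(v1, v2 <- comul v)
   F (s * S v2) (t * S v1))); last by linear_tac.
rewrite comul1_sum; last by linear_tac.
by congr (_ *: _); apply: eq_tlift => v1 v2; rewrite !mul1r.
Qed.

Lemma comul_antipode2 X (F : H -> H -> X) x : bilin F ->
  tlift F (comul (S (S x))) = \sw_(a, b <- comul x) F (S (S a)) (S (S b)).
Proof.
move=> bF; have [F1 F2] := bF; rewrite comul_antipode //.
by rewrite comul_antipode //; linear_tac.
Qed.

Lemma antipode2lE X (f : H -> X) x : lin f ->
  \sw_(a, b <- comul x) f (S b * S (S a)) = counit x *: f 1.
Proof.
move=> lf; rewrite -{1}antipode1 -(antipodelE (f := fun z => f (S z))); last by linear_tac.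
by apply: eq_tlift => a b; rewrite antipodeM.
Qed.

Lemma antipode2rE X (f : H -> X) x : lin f ->
  \sw_(a, b <- comul x) f (S (S b) * S a) = counit x *: f 1.
Proof.
move=> lf; rewrite -{1}antipode1 -(antipoderE (f := fun z => f (S z))); last by linear_tac.
by apply: eq_tlift => a b; rewrite antipodeM.
Qed.

Definition right_integral (h : H -> k) : Prop :=
  [/\ linf h, h 1 = 1 & forall x, \sw_(a, b <- comul x) (h a *: b) = h x *: (1 : H)].

Definition left_integral (h : H -> k) : Prop :=
  [/\ linf h, h 1 = 1 & forall x, \sw_(a, b <- comul x) (h b *: a) = h x *: (1 : H)].

Lemma right_integralE h X (f : H -> X) x : right_integral h -> lin f ->
  \sw_(a, b <- comul x) (h a *: f b) = h x *: f 1.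
Proof.
move=> [lh _ hx] lf; rewrite -linZ // -hx (lin_tliftE _ _ lf).
by apply: eq_tlift => a b; rewrite linZ.
Qed.

Lemma left_integralE h X (f : H -> X) x : left_integral h -> lin f ->
  \sw_(a, b <- comul x) (h b *: f a) = h x *: f 1.
Proof.
move=> [lh _ hx] lf; rewrite -linZ // -hx (lin_tliftE _ _ lf).
by apply: eq_tlift => a b; rewrite linZ.
Qed.

(** Applying invariance of [h] to a product and cancelling one factor against
    its antipode moves a leg of the coproduct to the other factor. *)
Lemma right_integral_shift h x y : right_integral h ->
  \sw_(a, b <- comul y) (h (S b * x) *: a) =
  \sw_(c, d <- comul x) (h (S y * c) *: d).
Proof.
move=> hr; have [lh _ _] := hr.
transitivity (\sw_(a, b <- comul y) \sw_(b1, b2 <- comul b) \sw_(c, d <- comul x)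
    (h (S b2 * c) *: (a * S b1 * d))).
  apply: eq_tlift => a b.
  rewrite -[a in LHS]mulr1 -(right_integralE (f := fun z => a * z)) //; last by linear_tac.
  rewrite comulM_sum; last by linear_tac.
  rewrite comul_antipode; last by linear_tac.
  by apply: eq_tlift => b1 b2; apply: eq_tlift => c d; rewrite mulrA.
rewrite -(coassoc (F := fun a b1 b2 => \sw_(c, d <- comul x) (h (S b2 * c) *: (a * S b1 * d))));
  last by trilinear_tac.
rewrite -(counitl (f := fun z => \sw_(c, d <- comul x) (h (S z * c) *: d))); last by linear_tac.
apply: eq_tlift => w b2.
rewrite (antipoderE (f := fun z => \sw_(c, d <- comul x) (h (S b2 * c) *: (z * d))));
  last by linear_tac.
by under eq_tlift => c d do rewrite mul1r.
Qed.

Lemma left_integral_shift h x y : left_integral h ->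
  \sw_(c, d <- comul x) (h (d * S y) *: c) =
  \sw_(a, b <- comul y) (h (x * S a) *: b).
Proof.
move=> hl; have [lh _ _] := hl; symmetry.
transitivity (\sw_(a, b <- comul y) \sw_(a1, a2 <- comul a) \sw_(c, d <- comul x)
    (h (d * S a1) *: (c * (S a2 * b)))).
  apply: eq_tlift => a b.
  rewrite -[b in LHS]mul1r -(left_integralE (f := fun z => z * b)) //; last by linear_tac.
  rewrite comulM_sum; last by linear_tac.
  under eq_tlift => c d do (rewrite comul_antipode; last by linear_tac).
  rewrite exchange_tlift.
  by apply: eq_tlift => a1 a2; apply: eq_tlift => c d; rewrite mulrA.
rewrite (coassoc (F := fun a1 a2 b => \sw_(c, d <- comul x) (h (d * S a1) *: (c * (S a2 * b)))));
  last by trilinear_tac.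
rewrite -(counitr (f := fun z => \sw_(c, d <- comul x) (h (d * S z) *: c))); last by linear_tac.
apply: eq_tlift => a1 w.
rewrite (antipodelE (f := fun z => \sw_(c, d <- comul x) (h (d * S a1) *: (c * z))));
  last by linear_tac.
by under eq_tlift => c d do rewrite mulr1.
Qed.

Lemma left_integral_twist h x y : left_integral h ->
  \sw_(c, d <- comul x) (h (S y * d) *: c) =
  \sw_(a, b <- comul y) (h (S a * x) *: S (S b)).
Proof.
move=> hl; have [lh _ _] := hl; symmetry.
transitivity (\sw_(a, b <- comul y) \sw_(a1, a2 <- comul a) \sw_(c, d <- comul x)
    (h (S a1 * d) *: (S (S b) * S a2 * c))).
  apply: eq_tlift => a b.
  rewrite -[S (S b) in LHS]mulr1 -(left_integralE (f := fun z => S (S b) * z)) //;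
    last by linear_tac.
  rewrite comulM_sum; last by linear_tac.
  rewrite comul_antipode; last by linear_tac.
  by apply: eq_tlift => a1 a2; apply: eq_tlift => c d; rewrite mulrA.
rewrite (coassoc (F := fun a1 a2 b =>
    \sw_(c, d <- comul x) (h (S a1 * d) *: (S (S b) * S a2 * c))));
  last by trilinear_tac.
rewrite -(counitr (f := fun z => \sw_(c, d <- comul x) (h (S z * d) *: c))); last by linear_tac.
apply: eq_tlift => a1 w.
rewrite (antipode2rE (f := fun z => \sw_(c, d <- comul x) (h (S a1 * d) *: (z * c))));
  last by linear_tac.
by under eq_tlift => c d do rewrite mul1r.
Qed.

(** If [h] is a right integral then [h \o S] is a left one, and a left and a
    right integral that are both normalized coincide. *)
Lemma right_integral_left h : right_integral h -> left_integral h.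
Proof.
move=> hr; have [lh h1 hx] := hr.
pose l : H -> k := fun x => h (S x).
have ll : left_integral l.
  split; [by rewrite /l; linear_tac | by rewrite /l antipode1 | move=> x].
  have := right_integral_shift 1 x hr.
  rewrite comul1_sum ?mulr1; last by linear_tac.
  by under eq_tlift => a b do rewrite mulr1.
suff -> : h = l by [].
have [lin_l l1 lx] := ll.
apply: funext => x; transitivity (conv h l x).
  rewrite -[LHS]mulr1 -l1 -(linfZ _ _ lin_l) -hx (lin_tliftE _ _ lin_l).
  by apply: (@eq_tlift _ _ _ k^o) => a b; rewrite linfZ.
rewrite -[RHS]mulr1 -h1 -(linfZ _ _ lh) -lx (lin_tliftE _ _ lh).
by apply: (@eq_tlift _ _ _ k^o) => a b; rewrite linfZ // mulrC.
Qed.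

End Antipode.

(** * Integrals and semisimplicity *)

Section DirectSum.
Context (k : fieldType) (M : lmodType k) (I : choiceType) (N : I -> set M).
Hypothesis sN : forall i, subspace (N i).
Hypothesis dN : direct_sum N.

Lemma sum_undup (s : seq I) (f : I -> M) :
  \sum_(i <- s) f i = \sum_(i <- undup s) f i *+ count_mem i s.
Proof. by rewrite -big_undup_iterop_count. Qed.

Definition others (i0 : I) : set M :=
  [set x | exists (s : seq I) (f : I -> M),
    [/\ i0 \notin s, forall i, N i (f i) & x = \sum_(i <- s) f i]].

Lemma subMn (P : set M) x n : subspace P -> P x -> P (x *+ n).
Proof. by move=> sP Px; rewrite -scaler_nat; exact: subZ. Qed.

Lemma others_intro i0 (s : seq I) (f : I -> M) :
  (forall i, N i (f i)) -> others i0 (\sum_(i <- s | i != i0) f i).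
Proof.
move=> Nf; exists [seq i <- s | i != i0], f; split=> //.
  by rewrite mem_filter eqxx.
by rewrite big_filter.
Qed.

Lemma others_subspace i0 : subspace (others i0).
Proof.
split=> [|a _ _ [s [f [si Nf ->]]] [t [g [ti Ng ->]]]].
  exists [::], (fun=> 0); split=> // [i|]; [exact: sub0 | by rewrite big_nil].
pose F i := a *: (f i *+ count_mem i s) + g i *+ count_mem i t.
have -> : a *: (\sum_(i <- s) f i) + \sum_(i <- t) g i =
    \sum_(i <- undup (s ++ t)) F i.
  have ext (r r' : seq I) (e : I -> M) : \sum_(i <- r) e i =
      \sum_(i <- undup (r ++ r')) e i *+ count_mem i r.
    rewrite sum_undup [RHS](bigID (mem r)) /= [X in _ + X]big1 ?addr0; last first.
      by move=> i ri; rewrite (count_memPn ri).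
    rewrite -[RHS]big_filter; apply: perm_big; apply: uniq_perm; rewrite ?undup_uniq //.
      by rewrite filter_uniq // undup_uniq.
    by move=> i; rewrite mem_filter !mem_undup mem_cat /=; case: (i \in r).
  rewrite (ext s t f) (ext t s g) scaler_sumr.
  have st : perm_eq (undup (t ++ s)) (undup (s ++ t)).
    by apply: uniq_perm; rewrite ?undup_uniq // => i; rewrite !mem_undup !mem_cat orbC.
  by rewrite (perm_big _ st) -big_split.
exists (undup (s ++ t)), F; split=> // [|i].
  by rewrite mem_undup mem_cat (negPf si) (negPf ti).
by apply: (sN i).2; exact: subMn.
Qed.

Lemma direct_sum_split i0 m : exists n l, [/\ N i0 n, others i0 l & m = n + l].
Proof.
have [s [f [Nf ->]]] := dN.1 m.
exists (\sum_(i <- s | i == i0) f i), (\sum_(i <- s | i != i0) f i); split.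
- by apply: sub_sum => // i /eqP ->.
- exact: others_intro.
- exact: bigID.
Qed.

Lemma others_disjoint i0 x : N i0 x -> others i0 x -> x = 0.
Proof.
move=> Nx [s [f [si Nf def_x]]].
pose g i := if i == i0 then - x else f i *+ count_mem i s.
have /(_ i0) : forall i, i \in i0 :: undup s -> g i = 0.
  apply: dN.2 => [||].
  - by rewrite /= mem_undup si undup_uniq.
  - move=> i; rewrite /g; case: eqP => [->|_]; last exact: subMn.
    by rewrite -scaleN1r; exact: subZ.
  - rewrite big_cons {1}/g eqxx; apply/eqP; rewrite addrC subr_eq0; apply/eqP.
    rewrite def_x sum_undup !big_seq; apply: eq_bigr => i; rewrite mem_undup /g.
    by case: eqP si => // ->; move/negPf ->.
by rewrite /g eqxx inE eqxx => /(_ isT)/eqP; rewrite oppr_eq0 => /eqP.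
Qed.

End DirectSum.

Lemma eq_tlift_sub (k : fieldType) (V W U : lmodType k) (N : set V) (F G : V -> W -> U) t :
  bilin F -> bilin G -> (forall v w, N v -> F v w = G v w) ->
  tens_sub N setT t -> tlift F t = tlift G t.
Proof.
move=> bF bG FG [s sN ->]; rewrite !tlift_sum // big_seq [RHS]big_seq.
by apply: eq_bigr => x /sN [Nx _]; exact: FG.
Qed.

Lemma functional_eq (k : fieldType) (V : lmodType k) (x y : V) :
  (forall f : V -> k, linf f -> f x = f y) -> x = y.
Proof.
move=> fxy; apply: contrapT => nxy.
have [||f lf [_ f1]] := @separate k V [set 0] (x - y).
- by split=> //= a u v -> ->; rewrite scaler0 addr0.
- by move=> /= /eqP; rewrite subr_eq0 => /eqP.
by move/eqP: f1; rewrite linfB // fxy // subrr eq_sym oner_eq0.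
Qed.

Section CosemisimpleIntegral.
Context (k : fieldType) (H : hopfAlgType k).

(** Some simple summand of the regular comodule carries a nonzero component [c]
    of [1]; as [1] is invariant so is [c], and that summand is the line of [c].
    The coordinate along [c] is an integral. *)
Lemma cosemisimple_right_integral : cosemisimple H ->
  exists h : H -> k, right_integral h.
Proof.
move=> [/(_ _ _ (comul_comodule H)) [I [N [simN dN]]] _].
have HM := comul_comodule H.
have cN i : right_subcomodule (@comul k H) (N i) by case: (simN i).
have sN i : subspace (N i) by case: (cN i).
have aN i (f : H -> k) x : linf f -> N i x -> N i (act comul f x).
  by move=> lf Nx; have [_] := (subcomodule_act _ (N i)).1 (cN i); exact.
have [i0 [c [l [Nc Ll def1 c0]]]] : exists i0 c l,
    [/\ N i0 c, others N i0 l, 1 = c + l & c <> 0].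
  apply: contrapT => /forallNP nc.
  have {}nc i : others N i 1.
    have [c [l [Nc Ll def1]]] := direct_sum_split sN dN i 1.
    have [c0|/eqP c0] := eqVneq c 0; first by rewrite def1 c0 add0r.
    by case: (nc i); exists c, l.
  have [s [f [Nf def1]]] := dN.1 1.
  have /eqP := oner_neq0 H; apply; rewrite def1 sum_undup big_seq big1 // => i _.
  have Ni : N i (f i *+ count_mem i s) by exact: subMn.
  apply: (others_disjoint sN dN Ni).
  have -> : f i *+ count_mem i s = 1 - \sum_(j <- s | j != i) f j.
    rewrite def1 (bigID (pred1 i)) /= addrK.
    rewrite (eq_bigr (fun=> f i)) => [|j /eqP -> //].
    by rewrite big_const_seq iter_addr_0.
  by apply: subB => //; [exact: others_subspace | exact: others_intro].
have aL (f : H -> k) x : linf f -> others N i0 x -> others N i0 (act comul f x).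
  move=> lf [s [g [si Ng ->]]]; exists s, (fun i => act comul f (g i)).
  by split=> // [i|]; [exact: aN | rewrite (lin_sum _ _ _ (act_lin _ lf))].
have act1 (f : H -> k) : linf f -> act (@comul k H) f 1 = f 1 *: 1.
  by move=> lf; rewrite /act comul1_sum //; linear_tac.
have actc (f : H -> k) : linf f -> act comul f c = f 1 *: c.
  move=> lf; apply/eqP; rewrite -subr_eq0; apply/eqP.
  apply: (others_disjoint sN dN (i0 := i0)).
    by apply: subB => //; [exact: aN | exact: subZ].
  have -> : act comul f c - f 1 *: c = f 1 *: l - act comul f l.
    apply/eqP; rewrite subr_eq addrAC eq_sym subr_eq addrC -scalerDr -def1.
    by rewrite -act1 // {1}def1 (linD (act_lin _ lf)).
  by apply: subB; [exact: others_subspace | apply: subZ => //; exact: others_subspace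
                  | exact: aL].
have Nline : [set x | exists a : k, x = a *: c] = N i0.
  have [_ _ /(_ [set x | exists a : k, x = a *: c])[||c00|//]] := simN i0.
  - apply/(subcomodule_act _); split=> [|f lf _ [a ->]]; first exact: subspace_line.
    by exists (a * f 1); rewrite (linZ (act_lin _ lf)) actc // scalerA.
  - by move=> _ [a ->]; exact: subZ.
  - case: c0; suff : [set 0] c by [].
    by rewrite -c00; exists 1; rewrite scale1r.
have [||h lh [hL hc]] := @separate k H (others N i0) c; first exact: others_subspace.
  by move=> Lc; exact/c0/(others_disjoint sN dN Nc Lc).
exists h; split=> //; first by rewrite def1 linfD // hc hL // addr0.
move=> x; apply: functional_eq => g lg.
have [n [y [Nn Ly def_x]]] := direct_sum_split sN dN i0 x.
move: Nn; rewrite -Nline => -[a def_n].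
have hx : h x = a by rewrite def_x def_n linfD // linfZ // hc hL // mulr1 addr0.
rewrite linfZ // hx (lin_tliftE _ _ lg).
transitivity (h (act comul g x)).
  rewrite /act (lin_tliftE _ _ lh); apply: (@eq_tlift _ _ _ k^o) => u v.
  by rewrite !linfZ // mulrC.
have lag := act_lin (@comul k H) lg.
rewrite def_x def_n (linD lag) (linZ lag) actc // linfD // !linfZ // hc mulr1.
by rewrite hL ?addr0 //; exact: aL.
Qed.

End CosemisimpleIntegral.

Section Maschke.
Context (k : fieldType) (H : hopfAlgType k) (M : lmodType k).
Context (rho : {linear M -> (M ⊗ H)%type}) (h : H -> k).
Local Notation S := (@antipode k H).
Hypothesis rhoM : right_comodule rho.
Hypothesis hl : left_integral h.

(** Averaging a linear projection over an integral makes it colinear. *)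
Lemma maschke (N : set M) : right_subcomodule rho N ->
  exists P : M -> M, [/\ lin P, forall m, N (P m), forall n, N n -> P n = n &
    forall m, rho (P m) = \sw_(n, c <- rho m) P n ⊗ c].
Proof.
move=> cN; have [sN Nrho] := cN; have [lh h1 _] := hl.
have [q lq [qN qid]] := lin_projection sN.
(* The projection m |-> q(m0)_0 h(q(m0)_1 S(m1)). *)
pose Q a c := \sw_(n, d <- rho (q a)) (h (d * S c) *: n).
have bQ : bilin Q by rewrite /Q; linear_tac.
have [Q1 Q2] := bQ.
exists (fun m => tlift Q (rho m)); split=> [|m|n Nn|m].
- by linear_tac.
- apply: sub_tlift => // a c; rewrite /Q.
  have lf : linf (fun d => h (d * S c)) by linear_tac.
  have [_ Nact] := (subcomodule_act rho N).1 cN.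
  exact: (Nact _ lf _ (qN a)).
- rewrite (eq_tlift_sub (N := N) (G := fun a c => \sw_(n, d <- rho a) (h (d * S c) *: n))) //;
    first last.
  + exact: Nrho.
  + by move=> v w Nv; rewrite /Q qid.
  + by linear_tac.
  rewrite (coact_sum (F := fun n d c => h (d * S c) *: n)) //; last by trilinear_tac.
  rewrite -[RHS](coact_counit n rhoM); apply: eq_tlift => a c.
  rewrite (antipoderE (f := fun z => h z *: a)); last by linear_tac.
  by rewrite h1 scale1r.
have lr : lin rho by exact: lin_linear.
rewrite (lin_tliftE _ _ lr).
transitivity (\sw_(a, c <- rho m) \sw_(c1, c2 <- comul c) Q a c1 ⊗ c2); last first.
  rewrite -(coact_sum (F := fun a c1 c2 => Q a c1 ⊗ c2)) //; last by trilinear_tac.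
  apply: eq_tlift => n c; rewrite (lin_tliftE _ _ (lin_purel c (@lin_id _ _))).
  by [].
apply: eq_tlift => a c.
transitivity (\sw_(n, d <- rho (q a)) \sw_(d1, d2 <- comul d) (h (d2 * S c) *: (n ⊗ d1))).
  rewrite -(coact_sum (F := fun n d1 d2 => h (d2 * S c) *: (n ⊗ d1))) //; last by trilinear_tac.
  rewrite /Q (lin_tliftE _ _ lr); apply: eq_tlift => n d.
  rewrite (linZ lr) -{1}[rho n]tlift_id (lin_tliftE _ _ (lin_scaler _ (@lin_id _ _))).
  by [].
transitivity (\sw_(n, d <- rho (q a)) \sw_(c1, c2 <- comul c) (h (d * S c1) *: (n ⊗ c2))).
  apply: eq_tlift => n d.
  have ln : lin (fun z : H => n ⊗ z) by linear_tac.
  transitivity (n ⊗ (\sw_(d1, d2 <- comul d) (h (d2 * S c) *: d1))).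
    by rewrite (lin_tliftE _ _ ln); apply: eq_tlift => d1 d2; rewrite linearZr_LR.
  rewrite left_integral_shift // (lin_tliftE _ _ ln).
  by apply: eq_tlift => c1 c2; rewrite linearZr_LR.
rewrite exchange_tlift; apply: eq_tlift => c1 c2.
rewrite /Q (lin_tliftE _ _ (lin_purel c2 (@lin_id _ _))).
by apply: eq_tlift => n d; rewrite linearZl_LR.
Qed.

Lemma subcomodule_ker (P : M -> M) : lin P ->
  (forall m, rho (P m) = \sw_(n, c <- rho m) P n ⊗ c) ->
  right_subcomodule rho [set m | P m = 0].
Proof.
move=> lP cP; apply/subcomodule_act; split; first exact: subspace_ker.
move=> f lf m /= Pm; rewrite /act (lin_tliftE _ _ lP).
have : act rho f (P m) = 0 by rewrite Pm (lin0 (act_lin rho lf)).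
rewrite /act cP tlift_tlift; last by linear_tac.
by move=> <-; apply: eq_tlift => n c; rewrite linZ.
Qed.

End Maschke.

(** * Semisimple comodules *)

Section Semisimple.
Context (k : fieldType) (C : coalgType k) (M : lmodType k).
Context (rho : {linear M -> (M ⊗ C)%type}).
Hypothesis rhoM : right_comodule rho.
Hypothesis complement : forall N, right_subcomodule rho N ->
  exists P : M -> M, [/\ lin P, forall m, N (P m), forall n, N n -> P n = n &
    right_subcomodule rho [set m | P m = 0]].

Let independent (X : set (set M)) : Prop :=
  (forall N, X N -> simple_for (right_subcomodule rho) N) /\
  forall (s : seq (set M)) (f : set M -> M), uniq s ->
    (forall N, N \in s -> X N /\ N (f N)) ->
    \sum_(N <- s) f N = 0 -> forall N, N \in s -> f N = 0.

Let total (X : set (set M)) : set M :=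
  [set m | exists2 s : seq (set M * M),
    forall x, x \in s -> X x.1 /\ x.1 x.2 & m = \sum_(x <- s) x.2].

Lemma total_mem X N m : X N -> N m -> total X m.
Proof.
move=> XN Nm; exists [:: (N, m)]; last by rewrite big_seq1.
by move=> x; rewrite inE => /eqP ->.
Qed.

Lemma total_family X m : (forall N, X N -> subspace N) -> total X m ->
  exists2 s : seq (set M), uniq s & exists f : set M -> M,
    (forall N, N \in s -> X N /\ N (f N)) /\ m = \sum_(N <- s) f N.
Proof.
move=> sX [s sP ->]; exists (undup [seq x.1 | x <- s]); first exact: undup_uniq.
exists (fun N => \sum_(x <- s | x.1 == N) x.2); split.
  move=> N; rewrite mem_undup => /mapP [x xs ->].
  have [Xx _] := sP x xs; split=> //; rewrite big_seq_cond.
  by apply: sub_sum => [|y /andP [ys /eqP <-]]; [exact: sX | exact: (sP y ys).2].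
rewrite (exchange_big_dep xpredT) //= big_seq [RHS]big_seq; apply: eq_bigr => x xs.
rewrite -big_filter (eq_filter (a2 := pred1 x.1)); last by move=> N; exact: eq_sym.
rewrite filter_pred1_uniq ?undup_uniq ?big_seq1 // mem_undup.
exact: map_f.
Qed.

Lemma total_subcomodule X : (forall N, X N -> right_subcomodule rho N) ->
  right_subcomodule rho (total X).
Proof.
move=> cX; apply/subcomodule_act; split.
  split=> [|a _ _ [s sP ->] [t tP ->]]; first by exists [::]; rewrite ?big_nil.
  exists ([seq (x.1, a *: x.2) | x <- s] ++ t).
    move=> x; rewrite mem_cat => /orP [/mapP [y ys ->]|/tP //].
    have [Xy y2] := sP y ys; split=> //=; exact: subZ (cX _ Xy).1 y2.
  by rewrite big_cat big_map scaler_sumr.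
move=> f lf _ [s sP ->]; exists [seq (x.1, act rho f x.2) | x <- s].
  move=> _ /mapP [x xs ->]; have [Xx x2] := sP x xs; split=> //=.
  by have [_] := (subcomodule_act rho x.1).1 (cX _ Xx); exact.
by rewrite (lin_sum _ _ _ (act_lin rho lf)) big_map.
Qed.

Lemma independent_chain (F : set (set (set M))) :
  F `<=` independent -> total_on F subset -> independent (\bigcup_(X in F) X).
Proof.
move=> FI totF; split=> [N [X FX XN]|s f us sN]; first exact: (FI X FX).1.
case: s us sN => // N0 s us sN.
have [[X0 FX0 _] _] := sN N0 (mem_head _ _).
have [X FX sX] : exists2 X, F X & forall N, N \in N0 :: s -> X N.
  have : forall N, N \in N0 :: s -> exists2 X, F X & X N.
    by move=> N /sN [[X FX XN] _]; exists X.
  elim: (N0 :: s) => [_|N s' IHs sF]; first by exists X0.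
  have [N' N's|X FX sX] := IHs; first by apply: sF; rewrite inE N's orbT.
  have [Y FY YN] := sF N (mem_head _ _).
  have [XY|YX] := totF X Y FX FY.
    by exists Y => // N'; rewrite inE => /orP [/eqP ->|/sX /XY].
  by exists X => // N'; rewrite inE => /orP [/eqP ->|/sX //]; exact: YX.
apply: (FI X FX).2 => // N Ns; split; first exact: sX.
by have [] := sN N Ns.
Qed.

(** A maximal independent family of simple subcomodules is everything: otherwise
    a complement of its sum contains one more simple subcomodule. *)
Lemma semisimple : direct_sum_of_simples (right_subcomodule rho).
Proof.
have [X [[simX indX] maxX]] := Zorn_bigcup independent_chain.
have cX N : X N -> right_subcomodule rho N by move/simX; case.
have sX N : X N -> subspace N by move/cX; case.
have [P [lP PX Pid cK]] := complement (total_subcomodule cX).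
have XM m : total X m.
  apply: contrapT => Xm.
  have K0 : [set m | P m = 0] <> [set 0].
    move=> K0; apply: Xm; suff -> : m = P m by exact: PX.
    apply/eqP; rewrite -subr_eq0; apply/eqP.
    suff : [set m | P m = 0] (m - P m) by rewrite K0.
    by rewrite /= (linB lP) (Pid _ (PX m)) subrr.
  have [T [n [TK _ simT]]] := exists_simple rhoM cK K0.
  have TX m' : T m' -> total X m' -> m' = 0 by move=> /TK /= <- /Pid.
  have [cT T0 _] := simT; have [sT _] := cT.
  apply: (maxX [set N | X N \/ N = T]).
    split=> [N XN|/(_ T (or_intror erefl)) XT]; first by left.
    apply: T0; apply/seteqP; split=> [x Tx|_ ->]; last exact: sub0.
    by apply: TX => //; exact: total_mem XT Tx.
  split=> [N [/simX|->] //|s f us sN s0].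
  have Xrest N : N \in s -> N != T -> X N /\ N (f N).
    by move=> Ns /eqP NT; have [[]] := sN N Ns.
  have rest : total X (\sum_(N <- s | N != T) f N).
    rewrite big_seq_cond; apply: sub_sum; first exact: (total_subcomodule cX).1.
    by move=> N /andP [Ns /(Xrest N Ns) [XN fN]]; exact: total_mem XN fN.
  have fT : T \in s -> f T = 0.
    move=> Ts; apply: TX; first by have [] := sN T Ts.
    move: s0; rewrite (bigD1_seq T) //= => /eqP; rewrite addr_eq0 => /eqP ->.
    by rewrite -scaleN1r; apply: subZ => //; exact: (total_subcomodule cX).1.
  have r0 : \sum_(N <- [seq N <- s | N != T]) f N = 0.
    rewrite big_filter -[RHS]s0 [RHS](bigID (pred1 T)) /= [X in X + _]big_seq_cond.
    rewrite [X in X + _]big1 ?add0r // => N /andP [Ns /eqP NT].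
    by rewrite NT fT // -NT.
  have {}r0 := indX _ f (filter_uniq _ us) _ r0.
  move=> N Ns; have [NT|NT] := eqVneq N T.
    by rewrite NT fT // -NT.
  apply: r0 => [N'|]; rewrite mem_filter; last by rewrite NT.
  by move=> /andP [NT' Ns']; exact: Xrest.
pose I := {N : set M | `[< X N >]}.
have XI (i : I) : X (val i) by exact/asboolP/(valP i).
exists I, (fun i => val i); split=> [i|]; first exact: simX.
split=> [m|s f us Nf s0].
  have [s us [f [sP ->]]] := total_family sX (XM m).
  exists (pmap insub s), (fun i : I => if val i \in s then f (val i) else 0).
  split=> [i|]; first by case: ifP => [/sP []//|_]; apply: sub0; exact: sX.
  rewrite -(big_map val xpredT (fun N => if N \in s then f N else 0)) /=.
  rewrite pmap_filter; last exact: insubK.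
  have /all_filterP -> : all (fun N => isSome (insub N : option I)) s.
    by apply/allP => N /sP [XN _]; rewrite insubT //; exact/asboolP.
  by rewrite big_seq [RHS]big_seq; apply: eq_bigr => N ->.
move=> i si.
pose g (N : set M) := if insub N is Some j then f (j : I) else 0.
have gE j : g (val j) = f j by rewrite /g valK.
rewrite -gE; apply: (indX [seq val j | j <- s]).
- by rewrite map_inj_uniq //; exact: val_inj.
- by move=> N /mapP [j js ->]; split=> //; rewrite gE.
- by rewrite big_map -[RHS]s0; apply: eq_bigr => j _; exact: gE.
- exact: map_f.
Qed.

End Semisimple.

Lemma left_integral_semisimple (k : fieldType) (H : hopfAlgType k) (h : H -> k)
    (M : lmodType k) (rho : {linear M -> (M ⊗ H)%type}) :
  left_integral h -> right_comodule rho -> direct_sum_of_simples (right_subcomodule rho).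
Proof.
move=> hl rhoM; apply: semisimple => // N cN.
have [P [lP PN Pid cP]] := maschke rhoM hl cN.
by exists P; split=> //; exact: subcomodule_ker.
Qed.

(** * Simple comodules over an algebraically closed field *)

(** Burnside's theorem, for the trace pairing: an irreducible algebra of
    matrices has zero orthogonal. An element of minimal nonzero rank has rank
    one: otherwise subtracting an eigenvalue on its image lowers the rank. *)
Lemma burnside (k : closedFieldType) n (R : 'M[k]_n -> Prop) :
  (forall a r s, R r -> R s -> R (a *: r + s)) ->
  (forall r s, R r -> R s -> R (r *m s)) ->
  (forall v w : 'rV_n, v != 0 -> exists2 r, R r & v *m r = w) ->
  forall c : 'M_n, (forall r, R r -> \tr (c *m r) = 0) -> c = 0.
Proof.
move=> RL RM Rirr c c0; have [//|cn0] := eqVneq c 0.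
have /rowV0Pn [v0 v0c v0n0] := cn0.
have exr : exists m, `[< exists r, [/\ R r, r != 0 & \rank r = m] >].
  have [r Rr v0r] := Rirr v0 v0 v0n0.
  exists (\rank r); apply/asboolP; exists r; split=> //.
  by apply/eqP => r0; move: v0n0; rewrite -v0r r0 mulmx0 eqxx.
have [m /asboolP [r [Rr rn0 rk]] minr] := ex_minnP exr.
have {}minr s : R s -> s != 0 -> (\rank r <= \rank s)%N.
  by move=> Rs sn0; rewrite rk; apply: minr; apply/asboolP; exists s.
have [i ri] : exists i, row i r != 0.
  apply/existsP; apply: contraNT rn0; rewrite negb_exists => /forallP r0.
  by apply/eqP/row_matrixP => i; move: (r0 i); rewrite negbK row0 => /eqP.
(* If the rank is larger, s maps row i r to e_j with row j r outside its span,
   so that r (s r - l) is nonzero, while s r - l kills an eigenvector in the row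
   space of r. *)
have rank1 : (\rank r <= 1)%N.
  rewrite leqNgt; apply/negP => rk2.
  have [j rj] : exists j, ~~ (row j r <= row i r)%MS.
    apply/existsP; rewrite -negb_forall; apply/negP => /forallP sub.
    have : (r <= row i r)%MS by apply/row_subP.
    by move/mxrankS; rewrite leqNgt (leq_ltn_trans (rank_leq_row _) rk2).
  have [s Rs si] := Rirr (row i r) (delta_mx 0 j) ri.
  have /submxP [D defD] : (row_base r *m s *m r <= row_base r)%MS.
    by rewrite eq_row_base submxMl.
  have [l] : exists l, eigenvalue D l.
    have /closed_rootP [l rDl] : size (char_poly D) != 1%N.
      by rewrite size_char_poly -lt0n (ltn_trans _ rk2).
    by exists l; rewrite eigenvalue_root_char.
  case/eigenvalueP => v vD vn0.
  pose X := s *m r - l%:M; pose y := v *m row_base r.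
  have yX : y *m X = 0.
    rewrite mulmxBr mul_mx_scalar /y -mulmxA [row_base r *m _]mulmxA defD.
    by rewrite mulmxA vD -scalemxAl subrr.
  have yn0 : y != 0.
    by apply: contra vn0 => /eqP y0; apply/eqP/(row_free_inj (row_base_free r)); rewrite mul0mx.
  have ycap : (y <= r :&: kermx X)%MS.
    rewrite sub_capmx -(eq_row_base r) submxMl; exact/sub_kermxP.
  have RX : R (r *m X).
    rewrite mulmxBr mulmxA mul_mx_scalar addrC -scaleNr.
    by apply: RL => //; apply: (RM) => //; exact: RM.
  have Xn0 : r *m X != 0.
    apply/eqP => /(congr1 (row i)); rewrite row0 !row_mul mulmxBr mulmxA si -rowE.
    rewrite mul_mx_scalar => /eqP; rewrite subr_eq0 => /eqP rij.
    by move: rj; rewrite rij scalemx_sub.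
  have := minr _ RX Xn0; rewrite -{1}(mxrank_mul_ker r X) -[leqRHS]addn0 leq_add2l.
  rewrite leqn0 mxrank_eq0 => /eqP cap0.
  by move: ycap; rewrite cap0 submx0 (negPf yn0).
have [a Ra va] := Rirr v0 (delta_mx 0 i) v0n0.
pose N := c *m a *m r.
have wN : (row i r <= N)%MS.
  rewrite rowE -va /N -!mulmxA [v0 *m (a *m r)]mulmxA mulmxA.
  by rewrite -!mulmxA; apply: submxMr.
have /submxP [D defN] : (N <= row i r)%MS.
  rewrite -(geq_leqif (mxrank_leqif_sup wN)).
  by rewrite rank_rV ri (leq_trans (mxrankM_maxr _ _)).
have Dw (w : 'rV_n) : w *m D = 0.
  have [b Rb <-] := Rirr (row i r) w ri.
  apply/matrixP => p q; rewrite !ord1 [RHS]mxE -(c0 (a *m r *m b));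
    last by apply: (RM) => //; exact: RM.
  by rewrite !mulmxA -/N defN -[D *m _ *m b]mulmxA mxtrace_mulC trace_mx11.
have D0 : D = 0.
  by apply/row_matrixP => j; rewrite rowE Dw row0.
by move: ri; rewrite -submx0 => /negP []; apply: submx_trans wN _; rewrite defN D0 mul0mx.
Qed.

(** * The coefficient coalgebra of a simple comodule *)

Definition dual_family (k : fieldType) (V : lmodType k) (I : finType) (w : I -> V)
    (f : I -> V -> k) : Prop :=
  (forall i, linf (f i)) /\ (forall i j, f i (w j) = (i == j)%:R).

Section Coefficients.
Context (k : fieldType) (C : coalgType k) (M : lmodType k).
Context (rho : {linear M -> (M ⊗ C)%type}).
Hypothesis rhoM : right_comodule rho.
Context (n : nat) (t : 'I_n -> M) (phi : 'I_n -> M -> k).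
Hypothesis tphi : dual_family t phi.
Hypothesis cT : right_subcomodule rho (span t).

Definition coef (i j : 'I_n) : C := \sw_(m, c <- rho (t j)) (phi i m *: c).

Lemma rho_coef j : rho (t j) = \sum_i t i ⊗ coef i j.
Proof.
have [lphi phit] := tphi.
rewrite -[LHS]tlift_id.
rewrite (eq_tlift_sub (N := span t) (G := fun m c => (\sum_i phi i m *: t i) ⊗ c));
  [| by linear_tac | by linear_tac | | by apply: cT.2; exact: mem_span].
  transitivity (\sw_(m, c <- rho (t j)) \sum_i t i ⊗ (phi i m *: c)).
    apply: eq_tlift => m c; rewrite (lin_sum _ _ _ (lin_purel c (@lin_id _ _))).
    apply: eq_bigr => i _.
    by rewrite linearZl_LR linearZr_LR.
  rewrite /tlift exchange_big /=; apply: eq_bigr => i _.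
  by rewrite /coef /tlift linear_sumr.
by move=> v c /(span_coord lphi phit) {1}->.
Qed.

Lemma act_coef f j : linf f -> act rho f (t j) = \sum_i f (coef i j) *: t i.
Proof. by move=> lf; rewrite /act rho_coef tlift_sum //; linear_tac. Qed.

Lemma comul_coef i j : comul (coef i j) = \sum_l coef i l ⊗ coef l j.
Proof.
have [lphi phit] := tphi; have lp := lphi i.
have lc : lin (@comul k C) by exact: lin_linear.
transitivity (\sw_(m, c <- rho (t j)) \sw_(c1, c2 <- comul c) (phi i m *: (c1 ⊗ c2))).
  rewrite /coef (lin_tliftE _ _ lc); apply: eq_tlift => m c.
  rewrite (linZ lc) -{1}[comul c]tlift_id.
  by rewrite (lin_tliftE _ _ (lin_scaler _ (@lin_id _ _))).
rewrite -(coact_sum (F := fun m c1 c2 => phi i m *: (c1 ⊗ c2))) //; last by trilinear_tac.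
rewrite rho_coef tlift_sum; last by linear_tac.
apply: eq_bigr => l _; rewrite /coef (lin_tliftE _ _ (lin_purel _ (@lin_id _ _))).
by apply: eq_tlift => m c; rewrite linearZl_LR.
Qed.

Lemma counit_coef i j : counit (coef i j) = (i == j)%:R.
Proof.
have [lphi phit] := tphi; have lp := lphi i.
rewrite -phit -[t j in RHS](coact_counit _ rhoM) (lin_tliftE _ _ lp).
have lc : linf (@counit k C) by exact: lin_scalar.
rewrite /coef (lin_tliftE _ _ lc); apply: (@eq_tlift _ _ _ k^o) => m c.
by rewrite linfZ // linearZ /= mulrC.
Qed.

Local Notation D := (span (fun x : 'I_n * 'I_n => coef x.1 x.2)).

Lemma mem_coef i j : D (coef i j).
Proof. exact: (mem_span (fun x : 'I_n * 'I_n => coef x.1 x.2) (i, j)). Qed.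

Lemma coef_subcoalgebra : subcoalgebra D.
Proof.
split=> [|_ [c ->]]; first exact: span_subspace.
rewrite (lin_sum _ _ _ (lin_linear _)); apply: sub_sum => [|[i j] _].
  by apply: tens_sub_subspace; exact: span_subspace.
rewrite linearZ; apply: subZ; first by apply: tens_sub_subspace; exact: span_subspace.
rewrite comul_coef; apply: sub_sum => [|l _].
  by apply: tens_sub_subspace; exact: span_subspace.
by apply: tens_sub_pure; exact: mem_coef.
Qed.

End Coefficients.

Section SimpleCoefficients.
Context (k : closedFieldType) (C : coalgType k) (M : lmodType k).
Context (rho : {linear M -> (M ⊗ C)%type}).
Hypothesis rhoM : right_comodule rho.
Context (n : nat) (t : 'I_n -> M) (phi : 'I_n -> M -> k).
Hypothesis tphi : dual_family t phi.
Hypothesis simT : simple_for (right_subcomodule rho) (span t).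
Local Notation u := (coef rho t phi).

Let cT : right_subcomodule rho (span t). Proof. by case: simT. Qed.

Lemma coef_free : free (fun x : 'I_n * 'I_n => u x.1 x.2).
Proof.
have [lphi phit] := tphi.
move=> c cu [i j]; pose c' : 'M[k]_n := \matrix_(i, j) c (i, j).
suff : c' = 0 by move/matrixP/(_ i j); rewrite !mxE.
pose mx (f : C -> k) : 'M[k]_n := \matrix_(p, q) f (u q p).
have actx (v : 'rV_n) f : linf f ->
    act rho f (\sum_p v 0 p *: t p) = \sum_q (v *m mx f) 0 q *: t q.
  move=> lf; rewrite (lin_sum _ _ _ (act_lin rho lf)).
  under eq_bigr => p _ do rewrite (linZ (act_lin rho lf)) (act_coef tphi cT) // scaler_sumr.
  rewrite exchange_big; apply: eq_bigr => q _ /=; rewrite mxE scaler_suml.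
  by apply: eq_bigr => p _; rewrite mxE scalerA.
apply: (@burnside _ _ (fun r => exists2 f, linf f & r = mx f)).
- move=> a _ _ [f lf ->] [g lg ->]; exists (fun x => a * f x + g x); first by linear_tac.
  by apply/matrixP => p q; rewrite !mxE.
- move=> _ _ [f lf ->] [g lg ->]; exists (conv g f); first exact: conv_lin.
  apply/matrixP => p q; rewrite !mxE /conv (comul_coef rhoM tphi cT).
  rewrite tlift_sum; last by linear_tac.
  by apply: eq_bigr => l _; rewrite !mxE mulrC.
- move=> v w vn0; pose x := \sum_p v 0 p *: t p.
  have Tx : span t x by exists (v 0).
  have xn0 : x <> 0.
    move=> x0; case/eqP: vn0; apply/rowP => p; rewrite mxE.
    by apply: (dual_free lphi phit x0).
  have [_ _ /(_ _ (subcomodule_orbit rhoM x))[|/seteqP [/(_ x)]|orbT]] := simT.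
  + by move=> _ [f lf ->]; have [_ Tact] := (subcomodule_act _ _).1 cT; exact: Tact.
  + by move=> /(_ (mem_orbit rhoM x)) /xn0.
  have : span t (\sum_q w 0 q *: t q) by exists (w 0).
  rewrite -orbT => -[f lf]; rewrite actx // => /eqP; rewrite -subr_eq0 => /eqP e.
  exists (mx f); first by exists f.
  apply/rowP => q; apply/eqP; rewrite eq_sym -subr_eq0; apply/eqP.
  move: q; apply: (dual_free lphi phit); rewrite -[RHS]e -sumrB.
  by apply: eq_bigr => q _; rewrite scalerBl.
move=> _ [f lf ->]; rewrite -[RHS](linf0 lf) -cu (linf_sum _ _ _ lf).
transitivity (\sum_p \sum_q c (p, q) * f (u p q)).
  by apply: eq_bigr => p _; rewrite mxE; apply: eq_bigr => q _; rewrite !mxE.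
by rewrite pair_big /=; apply: eq_bigr => -[p q] _; rewrite linfZ.
Qed.

Local Notation D := (span (fun x : 'I_n * 'I_n => u x.1 x.2)).

Lemma coef_dual : exists E : 'I_n -> 'I_n -> C -> k,
  [/\ forall i j, linf (E i j),
      forall a b i j, E a b (u i j) = ((a == i) && (b == j))%:R
    & forall x, D x -> x = \sum_i \sum_j E i j x *: u i j].
Proof.
have [E lE Eu] := free_dual coef_free.
exists (fun i j => E (i, j)); split=> [i j|a b i j|x Dx].
- exact: lE.
- by rewrite (Eu (a, b) (i, j)) xpair_eqE.
- by rewrite {1}(span_coord lE Eu Dx) pair_big; apply: eq_bigr => -[].
Qed.

Lemma sum_delta (F : 'I_n -> k) a : \sum_i (a == i)%:R * F i = F a.
Proof.
rewrite (bigD1 a) //= eqxx mul1r big1 ?addr0 // => i ia.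
by rewrite eq_sym (negPf ia) mul0r.
Qed.

Lemma sum_deltaZ (V : lmodType k) (F : 'I_n -> V) a : \sum_i (a == i)%:R *: F i = F a.
Proof.
rewrite (bigD1 a) //= eqxx scale1r big1 ?addr0 // => i ia.
by rewrite eq_sym (negPf ia) scale0r.
Qed.

Lemma span_n_gt0 : (0 < n)%N.
Proof.
case: simT => _; rewrite lt0n => T0 _; apply/eqP => n0; apply: T0.
apply/seteqP; split=> [_ [c ->]|_ ->]; last by apply: sub0; exact: span_subspace.
by rewrite big1 // => i _; move: (ltn_ord i); rewrite [X in (_ < X)%N]n0.
Qed.

Lemma contract_coefl (f : C -> k) i j : linf f ->
  \sw_(c, d <- comul (u i j)) (f c *: d) = \sum_l f (u i l) *: u l j.
Proof.
by move=> lf; rewrite (comul_coef rhoM tphi cT) tlift_sum //; linear_tac.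
Qed.

Lemma contract_coefr (f : C -> k) i j : linf f ->
  \sw_(c, d <- comul (u i j)) (f d *: c) = \sum_l f (u l j) *: u i l.
Proof.
by move=> lf; rewrite (comul_coef rhoM tphi cT) tlift_sum //; linear_tac.
Qed.

(** Contracting both legs of the comultiplication with dual functionals turns
    any nonzero element into a multiple of any prescribed coefficient. *)
Lemma coef_simple : simple_subcoalgebra D.
Proof.
have [E [lE Eu ED]] := coef_dual.
split; first exact: (coef_subcoalgebra rhoM tphi cT).
  move=> D0; have := mem_coef rho t phi (Ordinal span_n_gt0) (Ordinal span_n_gt0).
  rewrite D0 /= => /(congr1 counit); rewrite (counit_coef rhoM tphi) eqxx linear0.
  by move/eqP; rewrite oner_eq0.
move=> P [sP cP] PD; have [|] := pselect (P `<=` [set 0]).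
  by move=> P0; left; apply/seteqP; split=> // _ ->; exact: sub0.
move=> /existsNP [x /not_implyP [Px x0]]; right; apply/seteqP; split=> //.
have def_x := ED x (PD x Px).
have [[a b] /= cab] : exists ab : 'I_n * 'I_n, E ab.1 ab.2 x != 0.
  apply: contrapT => /forallNP nE; apply: x0; rewrite /= def_x.
  rewrite big1 // => i _; rewrite big1 // => j _.
  by have /negP := nE (i, j); rewrite negbK /= => /eqP ->; rewrite scale0r.
have Pcontract (f g : C -> k) y : linf f -> linf g -> P y ->
    P (\sw_(c, d <- comul y) (f c *: d)) /\ P (\sw_(c, d <- comul y) (g d *: c)).
  move=> lf lg Py; have Pyy := cP y Py; split; last exact: tens_sub_contract Pyy.
  apply: tens_sub_tlift Pyy => //; first by linear_tac.
  by move=> v w _ Pw; exact: subZ.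
apply: span_min => // -[r s] /=.
pose y := \sw_(c, d <- comul x) (E a r c *: d).
have Py : P y by have [] := Pcontract _ _ _ (lE a r) (lE a r) Px.
have lG : lin (fun x => \sw_(c, d <- comul x) (E a r c *: d)).
  by linear_tac.
have def_y : y = \sum_j E a j x *: u r j.
  rewrite /y {1}def_x (lin_sum _ _ _ lG).
  rewrite -[RHS](sum_deltaZ (fun i => \sum_j E i j x *: u r j) a).
  apply: eq_bigr => i _; rewrite (lin_sum _ _ _ lG) scaler_sumr.
  apply: eq_bigr => j _; rewrite (linZ lG) contract_coefl // scalerA mulrC -scalerA.
  congr (_ *: _); rewrite -(sum_deltaZ (fun l => u l j) r) scaler_sumr.
  by apply: eq_bigr => l _; rewrite Eu scalerA -natrM mulnb.
have lG' : lin (fun x => \sw_(c, d <- comul x) (E s b d *: c)).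
  by linear_tac.
have [_] := Pcontract _ _ _ (lE s b) (lE s b) Py.
rewrite def_y (lin_sum _ _ _ lG').
under eq_bigr => j _ do rewrite (linZ lG') contract_coefr //.
have -> : \sum_j E a j x *: (\sum_l E s b (u l j) *: u r l) = E a b x *: u r s.
  rewrite -(sum_deltaZ (fun j => E a j x *: u r s) b); apply: eq_bigr => j _.
  rewrite scalerA mulrC -scalerA; congr (_ *: _).
  rewrite -(sum_deltaZ (fun l => u r l) s) scaler_sumr.
  by apply: eq_bigr => l _; rewrite Eu scalerA -natrM mulnb andbC.
by move=> /(subZ (E a b x)^-1 sP); rewrite scalerA mulVf // scale1r.
Qed.

End SimpleCoefficients.

(** * Twisted characters and central functionals *)

Section Adjoint.
Context (k : fieldType) (H : hopfAlgType k).
Local Notation S := (@antipode k H).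
Implicit Type X : lmodType k.

Lemma adr_sum X (F : H -> H -> X) (x : H) : bilin F ->
  tlift F (adr x) = \sw_(a, b <- comul x) \sw_(a1, a2 <- comul a) F a2 (S a1 * b).
Proof.
move=> bF; have [F1 F2] := bF.
rewrite /adr /comul3 /tmap /tlift3 tlift_tlift; last by linear_tac.
rewrite (lin_tliftE _ _ (tlift_lin bF)); apply: eq_tlift => a b.
by rewrite tlift_tlift.
Qed.

Lemma adl_sum X (F : H -> H -> X) (x : H) : bilin F ->
  tlift F (adl x) = \sw_(a, b <- comul x) \sw_(a1, a2 <- comul a) F (a1 * S b) a2.
Proof.
move=> bF; have [F1 F2] := bF.
rewrite /adl /comul3 /tmap /tlift3 tlift_tlift; last by linear_tac.
rewrite (lin_tliftE _ _ (tlift_lin bF)); apply: eq_tlift => a b.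
by rewrite tlift_tlift.
Qed.

(** By hypothesis [x2 ⊗ S x1 * x3] equals [x3 ⊗ S x2 * S (S x1)], in which
    adjacent legs cancel. *)
Lemma twisted_invariant (x : H) : comul x = \sw_(a, b <- comul x) b ⊗ S (S a) ->
  adr x = x ⊗ 1.
Proof.
move=> tx; have bp : bilin (@pure k H H) by linear_tac.
rewrite -[LHS]tlift_id adr_sum // tx tlift_tlift; last by linear_tac.
rewrite -(coassoc (F := fun a b1 b2 => b2 ⊗ (S b1 * S (S a)))); last by trilinear_tac.
transitivity (\sw_(w, b <- comul x) (counit w *: (b ⊗ (1 : H)))).
  by apply: eq_tlift => w b; rewrite (antipode2lE (f := fun z : H => b ⊗ z)) //; linear_tac.
by rewrite (counitl (f := fun z => z ⊗ (1 : H))) //; linear_tac.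
Qed.

Definition central (z : H -> k) : Prop :=
  forall x, \sw_(a, b <- comul x) (z a *: b) = \sw_(a, b <- comul x) (z b *: a).

Lemma unit_subcoalgebra : subcoalgebra [set x : H | exists a : k, x = a *: 1].
Proof.
split=> [|_ [a ->]]; first exact: subspace_line.
rewrite linearZ; apply: subZ; first by apply: tens_sub_subspace; exact: subspace_line.
by rewrite /= comul1; apply: tens_sub_pure; exists 1; rewrite scale1r.
Qed.

End Adjoint.

Section CentralFunctionals.
Context (k : closedFieldType) (H : hopfAlgType k).
Local Notation S := (@antipode k H).
Context (M : lmodType k) (rho : {linear M -> (M ⊗ H)%type}).
Hypothesis rhoM : right_comodule rho.
Hypothesis S2 : forall D : set H, simple_subcoalgebra D ->
  forall x, D x -> D (S (S x)).
Context (n : nat) (t : 'I_n -> M) (phi : 'I_n -> M -> k).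
Hypothesis tphi : dual_family t phi.
Hypothesis simT : simple_for (right_subcomodule rho) (span t).
Local Notation u := (coef rho t phi).
Local Notation D := (span (fun x : 'I_n * 'I_n => u x.1 x.2)).

Let cT : right_subcomodule rho (span t). Proof. by case: simT. Qed.

(** [S \o S] induces on the dual matrix algebra of [D] an endomorphism, which is
    implemented by a nonzero matrix [q]; its entries are coordinates of the
    images of the coefficients, and [x] is the trace twisted by [q]. *)
Lemma twisted_character : exists x : H,
  [/\ D x, x <> 0 & comul x = \sw_(a, b <- comul x) b ⊗ S (S a)].
Proof.
have [E [lE Eu ED]] := coef_dual rhoM tphi simT.
have D2 i j : D (S (S (u i j))).
  by apply: S2 (mem_coef _ _ _ i j); exact: coef_simple.
have lS2 : lin (fun x => S (S x)) by linear_tac.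
pose i0 := Ordinal (span_n_gt0 simT).
have [j [a [b q0]]] : exists j a b, E j b (S (S (u i0 a))) != 0.
  apply: contrapT => nq; have : counit (S (S (u i0 i0))) = 1.
    by rewrite !counit_antipode (counit_coef rhoM tphi) eqxx.
  rewrite (ED _ (D2 i0 i0)) big1 ?linear0; first by move/eqP; rewrite eq_sym oner_eq0.
  move=> p _; rewrite big1 // => r _.
  have [->|Ep] := eqVneq (E p r (S (S (u i0 i0)))) 0; first by rewrite scale0r.
  by case: nq; exists p, i0, r.
pose q m l := E j l (S (S (u i0 m))).
(* The left contraction of the coproduct of S(S(u i0 l)) with E j m, computed
   from the coproduct of u i0 l and from the coordinates of S(S(u i0 l)). *)
have q_swap l m : \sum_p q p m *: S (S (u p l)) = \sum_p q l p *: u m p.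
  transitivity (\sw_(c, d <- comul (S (S (u i0 l)))) (E j m c *: d)).
    rewrite comul_antipode2; last by linear_tac.
    by rewrite (comul_coef rhoM tphi cT) tlift_sum //; linear_tac.
  have lG : lin (fun x => \sw_(c, d <- comul x) (E j m c *: d)) by linear_tac.
  rewrite [S (S (u i0 l)) in LHS](ED _ (D2 i0 l)) (lin_sum _ _ _ lG).
  rewrite -[RHS](sum_deltaZ (fun i => \sum_p E i p (S (S (u i0 l))) *: u m p) j).
  apply: eq_bigr => i _; rewrite (lin_sum _ _ _ lG) scaler_sumr.
  apply: eq_bigr => p _; rewrite (linZ lG) (contract_coefl rhoM tphi simT) //.
  rewrite scalerA mulrC -scalerA; congr (_ *: _).
  rewrite -(sum_deltaZ (fun l => u l p) m) scaler_sumr.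
  by apply: eq_bigr => r _; rewrite Eu scalerA -natrM mulnb.
have [x def_x] : exists x, x = \sum_m \sum_l q m l *: u m l.
  by exists (\sum_m \sum_l q m l *: u m l).
have x_sum (F : H -> H -> (H ⊗ H)%type) : bilin F ->
    tlift F (comul x) = \sum_m \sum_l \sum_r q m l *: F (u m r) (u r l).
  move=> bF; have lF : lin (fun y => tlift F (comul y)) by linear_tac.
  rewrite def_x (lin_sum _ _ _ lF); apply: eq_bigr => m _.
  rewrite (lin_sum _ _ _ lF); apply: eq_bigr => l _.
  by rewrite (linZ lF) (comul_coef rhoM tphi cT) tlift_sum // scaler_sumr.
exists x; split.
- rewrite def_x; apply: sub_sum => [|m _]; first exact: span_subspace.
  apply: sub_sum => [|l _]; first exact: span_subspace.
  by apply: subZ; [exact: span_subspace | exact: mem_coef].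
- move=> x0; case/eqP: q0; rewrite -/(q a b).
  have := coef_free rhoM tphi simT; rewrite def_x pair_big /= in x0.
  by move=> /(_ (fun y => q y.1 y.2) x0 (a, b)).
rewrite -[LHS]tlift_id !x_sum; [| by linear_tac | by linear_tac].
transitivity (\sum_r \sum_l \sum_m q m l *: (u r l ⊗ S (S (u m r)))); last first.
  under [RHS]eq_bigr => m _ do rewrite exchange_big.
  rewrite [RHS]exchange_big; apply: eq_bigr => r _ /=.
  by rewrite [RHS]exchange_big.
apply: eq_bigr => r _; rewrite exchange_big; apply: eq_bigr => l _ /=.
under [RHS]eq_bigr => m _ do rewrite -linearZr_LR.
rewrite -linear_sumr q_swap linear_sumr.
by apply: eq_bigr => p _; rewrite linearZr_LR.
Qed.

(** Either [1] is a coefficient, and the comodule is trivial; or a central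
    functional takes the value [1] at the twisted character of [D] and [0] at
    [1]. It acts on the comodule by a nonzero scalar, so that a combination of
    it with the counit kills the comodule without vanishing at [1]. *)
Lemma trivial_or_killed :
  (forall g : H -> k, linf g -> exists z : H -> k,
     [/\ linf z, central z & forall x, adr x = x ⊗ 1 -> z x = g x]) ->
  (forall m, span t m -> rho m = m ⊗ 1) \/
  exists w : H -> k, [/\ linf w, central w, w 1 = 1 &
    forall m, span t m -> act rho w m = 0].
Proof.
move=> enough_central.
have lr : lin rho by exact: lin_linear.
have simD := coef_simple rhoM tphi simT.
have [D1|D1] := pselect (D 1).
  left; have [_ _ /(_ _ (unit_subcoalgebra H))[_ [a ->]|/seteqP [/(_ 1)]|lineD]] := simD.
  - by apply: subZ D1; exact: span_subspace.
  - move=> line1 _; have : (1 : H) = 0 by apply: line1; exists 1; rewrite scale1r.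
    by move/eqP; rewrite oner_eq0.
  have uE i j : u i j = (i == j)%:R *: 1.
    have : [set x : H | exists a : k, x = a *: 1] (u i j) by rewrite lineD; exact: mem_coef.
    move=> [a ua]; rewrite ua; congr (_ *: _).
    by rewrite -(counit_coef rhoM tphi i j) ua linearZ /= counit1 mulr1.
  move=> _ [c ->]; rewrite (lin_sum _ _ _ lr).
  rewrite (lin_sum _ _ _ (lin_purel 1 (@lin_id _ _))); apply: eq_bigr => j _.
  rewrite (linZ lr) linearZl_LR /= (rho_coef tphi cT); congr (_ *: _).
  rewrite -(sum_deltaZ (fun i => t i ⊗ (1 : H)) j); apply: eq_bigr => i _.
  by rewrite uE linearZr_LR eq_sym.
right; have [x [Dx xn0 tx]] := twisted_character.
have [||g lg [g1 gx]] := @separate k H [set x : H | exists a : k, x = a *: 1] x.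
- exact: subspace_line.
- move=> [a def_x]; apply: D1; have [a0|an0] := eqVneq a 0.
    by case: xn0; rewrite def_x a0 scale0r.
  suff -> : 1 = a^-1 *: x by apply: subZ Dx; exact: span_subspace.
  by rewrite def_x scalerA mulVf // scale1r.
have [z [lz cz zg]] := enough_central g lg.
have z1 : z 1 = 0.
  rewrite zg; first by apply: g1; exists 1; rewrite scale1r.
  rewrite -[LHS]tlift_id adr_sum; last by linear_tac.
  rewrite comul1_sum; last by linear_tac.
  by rewrite comul1_sum ?antipode1 ?mulr1 //; linear_tac.
have zx : z x = 1 by rewrite zg // twisted_invariant.
have [E [lE Eu ED]] := coef_dual rhoM tphi simT.
have zu i a j : z (u i a) = (i == a)%:R * z (u j j).
  have := congr1 (E a j) (cz (u i j)).
  rewrite (contract_coefl rhoM tphi simT) // (contract_coefr rhoM tphi simT) //.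
  rewrite !(linf_sum _ _ _ (lE a j)).
  under eq_bigr => l _ do rewrite linfZ // Eu eqxx andbT mulrC.
  rewrite sum_delta => ->.
  under eq_bigr => l _ do rewrite linfZ // Eu -mulnb natrM mulrA mulrC.
  by rewrite sum_delta mulrC eq_sym.
pose j0 := Ordinal (span_n_gt0 simT); pose zeta := z (u j0 j0).
have zeta0 : zeta != 0.
  apply/eqP => zeta0; have /eqP := zx; rewrite (ED x Dx) (linf_sum _ _ _ lz).
  rewrite big1 ?(eq_sym 0) ?oner_eq0 // => i _; rewrite (linf_sum _ _ _ lz) big1 // => j _.
  by rewrite linfZ // (zu i j j0) -/zeta zeta0 !mulr0.
have lw : linf (fun y => counit y - zeta^-1 * z y).
  apply: lin_add; first exact: lin_scalar.
  by apply: lin_opp; apply: lin_kmulr.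
exists (fun y => counit y - zeta^-1 * z y); split=> //.
- move=> y; rewrite /tlift.
  under eq_bigr => i _ do rewrite scalerBl -scalerA.
  under [RHS]eq_bigr => i _ do rewrite scalerBl -scalerA.
  rewrite !sumrB -!scaler_sumr; congr (_ - _ *: _); last exact: cz.
  by rewrite (comul_counitl y : \sum_(i <- _) _ = _) (comul_counitr y : \sum_(i <- _) _ = _).
- by rewrite counit1 z1 mulr0 subr0.
move=> _ [c ->]; rewrite (lin_sum _ _ _ (act_lin rho lw)) big1 // => j _.
rewrite (linZ (act_lin rho lw)) (act_coef tphi cT) // big1 ?scaler0 // => i _.
rewrite (counit_coef rhoM tphi) (zu i j j0) -/zeta mulrC mulfK // subrr.
by rewrite scale0r.
Qed.

End CentralFunctionals.

(** * Right-normal quantum subgroups *)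

Section RightNormal.
Context (k : closedFieldType) (A B : hopfAlgType k) (p : {lrmorphism A -> B}).
Local Notation SA := (@antipode k A).
Implicit Type X : lmodType k.
Hypothesis hp : hopf_morphism p.
Hypothesis psurj : forall y : B, exists x : A, p x = y.

Let lp : lin p. Proof. exact: lin_linear. Qed.
Let lc : lin (@comul k A). Proof. exact: lin_linear. Qed.

Lemma comul_p X (F : B -> B -> X) x : bilin F ->
  tlift F (comul (p x)) = \sw_(a, b <- comul x) F (p a) (p b).
Proof. by move=> bF; have [-> _ _] := hp; rewrite /tmap tlift_tlift. Qed.

(** Restriction of the right regular comodule of [A] to [B]. *)
Definition restrict (x : A) : (A ⊗ B)%type := \sw_(a, b <- comul x) a ⊗ p b.

Lemma restrict_lin : lin restrict.
Proof. by rewrite /restrict; linear_tac. Qed.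

Definition rhoB : {linear A -> (A ⊗ B)%type} := linmap restrict_lin.

Lemma rhoB_sum X (F : A -> B -> X) x : bilin F ->
  tlift F (rhoB x) = \sw_(a, b <- comul x) F a (p b).
Proof. by move=> bF; rewrite /= /restrict tlift_tlift. Qed.

Lemma rhoB_comodule : right_comodule rhoB.
Proof.
have lr : lin rhoB by exact: restrict_lin.
apply: right_comodule_intro => x.
  rewrite !rhoB_sum; [| by linear_tac | by linear_tac].
  transitivity (\sw_(a, b <- comul x) \sw_(a1, a2 <- comul a) a1 ⊗ (p a2 ⊗ p b)).
    by apply: eq_tlift => a b; rewrite rhoB_sum //; linear_tac.
  rewrite (coassoc (F := fun a1 a2 b => a1 ⊗ (p a2 ⊗ p b))); last by trilinear_tac.
  by apply: eq_tlift => a b; rewrite comul_p //; linear_tac.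
rewrite rhoB_sum; last by linear_tac.
rewrite -[RHS](counitr (f := fun z => z)) //; apply: eq_tlift => a b.
by have [_ -> _] := hp.
Qed.

Lemma act_rhoB f x : linf f -> act rhoB f x = act comul (fun y => f (p y)) x.
Proof. by move=> lf; rewrite /act rhoB_sum //; linear_tac. Qed.

Lemma rhoB_subcomodule N : right_subcomodule (@comul k A) N -> right_subcomodule rhoB N.
Proof.
move=> /subcomodule_act [sN Nact]; apply/subcomodule_act; split=> // f lf m Nm.
by rewrite act_rhoB //; apply: Nact => //; linear_tac.
Qed.

(** In [x3 ⊗ x1 * (S x2 * x4)] the additional leg [x1] cancels against [S x2] and
    undoes the conjugation. *)
Lemma adr_collapse X (F : A -> A -> X) x : bilin F ->
  \sw_(u, v <- comul x) \sw_(a, b <- comul v) \sw_(a1, a2 <- comul a) F a2 (u * (SA a1 * b))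
  = \sw_(a, b <- comul x) F a b.
Proof.
move=> bF; have [F1 F2] := bF.
transitivity (\sw_(u, v <- comul x) \sw_(a1, w <- comul v) \sw_(a2, b <- comul w)
    F a2 (u * SA a1 * b)).
  apply: eq_tlift => u v; rewrite coassoc; last by trilinear_tac.
  apply: eq_tlift => a1 w.
  by apply: eq_tlift => a2 b; rewrite mulrA.
rewrite -(coassoc (F := fun u a1 w => \sw_(a2, b <- comul w) F a2 (u * SA a1 * b)));
  last by trilinear_tac.
rewrite -[RHS](counitl (f := fun w => \sw_(a2, b <- comul w) F a2 b)); last by linear_tac.
apply: eq_tlift => v w.
rewrite (antipoderE (f := fun z => \sw_(a2, b <- comul w) F a2 (z * b))); last by linear_tac.
by under eq_tlift => a2 b do rewrite mul1r.
Qed.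

Context (rho : {linear B -> (B ⊗ A)%type}).
Hypothesis rho_comodule : right_comodule rho.
Hypothesis rho_p : forall x, rho (p x) = tmap p idfun (adr x).

Let lr : lin rho. Proof. exact: lin_linear. Qed.

Lemma rho_sum X (F : B -> A -> X) x : bilin F -> tlift F (rho (p x)) =
  \sw_(a, b <- comul x) \sw_(a1, a2 <- comul a) F (p a2) (SA a1 * b).
Proof.
move=> bF; have [F1 F2] := bF; rewrite rho_p /tmap tlift_tlift // adr_sum //.
by linear_tac.
Qed.

Lemma rho_adr X (F : B -> B -> X) b : bilin F ->
  \sw_(b0, b1 <- rho b) F b0 (p b1) = tlift F (adr b).
Proof.
move=> bF; have [F1 F2] := bF; have [x <-] := psurj b.
rewrite adr_sum // comul_p; last by linear_tac.
rewrite rho_sum; last by linear_tac.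
apply: eq_tlift => u v; rewrite comul_p; last by linear_tac.
by apply: eq_tlift => c d; have [_ _ ->] := hp; rewrite rmorphM.
Qed.

(** Functions on the quotient by the subgroup. *)
Definition invariants : set A := [set x | restrict x = x ⊗ 1].
Local Notation K := invariants.

Lemma invariants_subspace : subspace K.
Proof.
split=> [|a x y]; rewrite /invariants /= ?(lin0 restrict_lin) ?linear0l //.
by move=> Kx Ky; rewrite restrict_lin Kx Ky linearPl.
Qed.

Lemma invariantsE X (F : A -> B -> X) x : bilin F -> K x ->
  \sw_(a, b <- comul x) F a (p b) = F x 1.
Proof. by move=> bF Kx; rewrite -rhoB_sum //= Kx tliftE. Qed.

Lemma p_invariants x : K x -> p x = counit x *: 1.
Proof.
move=> Kx; rewrite -(invariantsE (F := fun a b => counit a *: b)) //; last by linear_tac.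
by rewrite (counitl (f := p)).
Qed.

(** Right invariants are left invariants: for [x] in [K] the coaction [rho] on
    the second leg of [restrict x] is that on [1], and multiplying by the first
    leg undoes the conjugation. This is the main use of normality. *)
Lemma invariants_left X (F : B -> A -> X) x : bilin F -> K x ->
  \sw_(a, b <- comul x) F (p a) b = F 1 x.
Proof.
move=> bF Kx; have [F1 F2] := bF.
rewrite -(adr_collapse (F := fun a b => F (p a) b)); last by linear_tac.
transitivity (\sw_(a, b <- comul x) \sw_(b0, b1 <- rho (p b)) F b0 (a * b1)).
  by apply: eq_tlift => a b; rewrite rho_sum //; linear_tac.
rewrite (invariantsE (F := fun a b => \sw_(b0, b1 <- rho b) F b0 (a * b1))) //;
  last by linear_tac.
rewrite -[X in rho X](rmorph1 p) rho_sum; last by linear_tac.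
rewrite comul1_sum; last by linear_tac.
rewrite comul1_sum; last by linear_tac.
by rewrite antipode1 rmorph1 !mulr1.
Qed.

Lemma invariants_contractl (g : A -> k) x : linf g -> K x ->
  K (\sw_(a, b <- comul x) (g a *: b)).
Proof.
move=> lg Kx; rewrite /invariants /= (lin_tliftE _ _ restrict_lin).
transitivity (\sw_(v, b <- comul x) \sw_(a, b1 <- comul v) (g a *: (b1 ⊗ p b))).
  rewrite coassoc; last by trilinear_tac.
  apply: eq_tlift => a b; rewrite (linZ restrict_lin) /restrict.
  by rewrite (lin_tliftE _ _ (lin_scaler _ (@lin_id _ _))).
rewrite (invariantsE (F := fun v b => \sw_(a, b1 <- comul v) (g a *: (b1 ⊗ b)))) //;
  last by linear_tac.
rewrite (lin_tliftE _ _ (lin_purel 1 (@lin_id _ _))).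
by apply: eq_tlift => a b; rewrite linearZl_LR.
Qed.

Lemma invariants_subcomodule : right_subcomodule (@comul k A) K.
Proof.
apply/subcomodule_act; split=> [|f lf x Kx]; first exact: invariants_subspace.
rewrite /invariants /=; apply: tensor_eql => g lg.
rewrite rhoB_sum; last by linear_tac.
rewrite tliftE; last by linear_tac.
have lG : lin (fun y => \sw_(a, b <- comul y) (g a *: p b)) by linear_tac.
rewrite {1}/act (lin_tliftE _ _ lG).
pose y := \sw_(a, b <- comul x) (g a *: b).
have Ky : K y by exact: invariants_contractl.
transitivity (\sw_(a, b <- comul y) (f b *: p a)).
  have lH : lin (fun y => \sw_(a, b <- comul y) (f b *: p a)) by linear_tac.
  rewrite /y (lin_tliftE _ _ lH).
  transitivity (\sw_(a, b <- comul x) \sw_(a1, a2 <- comul a) (g a1 * f b) *: p a2).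
    apply: eq_tlift => a b; rewrite (linZ lG).
    rewrite (lin_tliftE _ _ (lin_scaler _ (@lin_id _ _))).
    by apply: eq_tlift => a1 a2; rewrite scalerA mulrC.
  rewrite (coassoc (F := fun a1 a2 b => (g a1 * f b) *: p a2)); last by trilinear_tac.
  apply: eq_tlift => a b; rewrite (linZ lH).
  rewrite (lin_tliftE _ _ (lin_scaler _ (@lin_id _ _))).
  by apply: eq_tlift => a1 a2; rewrite scalerA.
rewrite (invariants_left (F := fun a b => f b *: a)) //; last by linear_tac.
congr (_ *: _); rewrite /y /act (lin_tliftE _ _ lf) (lin_tliftE _ _ lg).
by apply: (@eq_tlift _ _ _ k^o) => a b; rewrite !linfZ // mulrC.
Qed.

(** [P] is averaging along the fibres of the quotient. *)
Context (P : A -> A).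
Hypotheses (lP : lin P) (PK : forall x, K (P x)) (Pid : forall x, K x -> P x = x).
Hypothesis cP : forall x, comul (P x) = \sw_(a, b <- comul x) P a ⊗ b.

(** In the end this is the integral of [B] pulled back along [p]. *)
Definition theta (x : A) : k := counit (P x).

Lemma theta_lin : linf theta.
Proof. by rewrite /theta; linear_tac. Qed.

Lemma theta_p x : \sw_(a, b <- comul x) (theta a *: p b) = theta x *: 1.
Proof.
rewrite -p_invariants //.
rewrite -[RHS](counitl (f := p)) // cP tlift_tlift //.
by linear_tac.
Qed.

(** Contracting the coacting leg with [theta] projects [B] onto its elements
    invariant under the adjoint coaction; [g] is evaluated after it. *)
Definition central_of (g : B -> k) (b : B) : k :=
  \sw_(b0, b1 <- rho b) (g b0 * theta b1 : k^o).

Lemma central_of_lin g : linf g -> linf (central_of g).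
Proof. by move=> lg; have lt := theta_lin; rewrite /central_of; linear_tac. Qed.

Lemma central_of_coinvariant g b : linf g ->
  \sw_(b0, b1 <- rho b) (central_of g b0 *: p b1) = central_of g b *: 1.
Proof.
move=> lg; have lt := theta_lin.
transitivity (\sw_(b0, b1 <- rho b) \sw_(c, d <- rho b0) ((g c * theta d) *: p b1)).
  apply: eq_tlift => b0 b1.
  by rewrite (lin_tliftE _ _ (lin_scalel (p b1) (@lin_id k k^o))).
rewrite (coact_sum (F := fun c d b1 => (g c * theta d) *: p b1)) //; last by trilinear_tac.
rewrite (lin_tliftE _ _ (lin_scalel 1 (@lin_id k k^o))); apply: eq_tlift => b0 b1.
rewrite -scalerA -theta_p (lin_tliftE _ _ (lin_scaler _ (@lin_id _ _))).
by apply: eq_tlift => c d; rewrite scalerA.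
Qed.

Lemma central_of_central g : linf g -> central (central_of g).
Proof.
move=> lg y; have [x <-] := psurj y; have lz := central_of_lin lg.
set z := central_of g in lz *.
rewrite comul_p; last by linear_tac.
rewrite comul_p; last by linear_tac.
rewrite -(adr_collapse (F := fun a b => z (p a) *: p b)); last by linear_tac.
apply: eq_tlift => u v.
transitivity (p u * (z (p v) *: 1)); last by rewrite -scalerAr mulr1.
rewrite -central_of_coinvariant // rho_sum; last by linear_tac.
rewrite (lin_tliftE _ _ (lin_mulr (p u) (@lin_id _ _))); apply: eq_tlift => a b.
rewrite (lin_tliftE _ _ (lin_mulr (p u) (@lin_id _ _))); apply: eq_tlift => a1 a2.
by rewrite rmorphM -scalerAr.
Qed.

Lemma central_of_invariant g b : linf g -> adr b = b ⊗ 1 -> central_of g b = g b.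
Proof.
move=> lg adb; pose y := \sw_(b0, b1 <- rho b) (g b0 *: b1).
have Ky : K y.
  rewrite /invariants /= /y (lin_tliftE _ _ restrict_lin).
  transitivity (\sw_(b0, b1 <- rho b) \sw_(c, d <- comul b1) (g b0 *: (c ⊗ p d))).
    apply: eq_tlift => b0 b1; rewrite (linZ restrict_lin) /restrict.
    by rewrite (lin_tliftE _ _ (lin_scaler _ (@lin_id _ _))).
  rewrite -(coact_sum (F := fun b0 c d => g b0 *: (c ⊗ p d))) //; last by trilinear_tac.
  rewrite (rho_adr (F := fun b0 b1 => \sw_(c, d <- rho b0) (g c *: (d ⊗ b1))));
    last by linear_tac.
  rewrite adb tliftE; last by linear_tac.
  rewrite (lin_tliftE _ _ (lin_purel 1 (@lin_id _ _))).
  by apply: eq_tlift => c d; rewrite linearZl_LR.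
have lt := theta_lin.
transitivity (theta y).
  rewrite /central_of /y (lin_tliftE _ _ lt).
  by apply: (@eq_tlift _ _ _ k^o) => b0 b1; rewrite linfZ.
have lcu : linf (@counit k A) by exact: lin_scalar.
rewrite /theta Pid // /y (lin_tliftE _ _ lcu).
rewrite -[RHS](@coact_counitE _ _ _ rho k^o g b) //.
by apply: (@eq_tlift _ _ _ k^o) => b0 b1; rewrite linfZ // mulrC.
Qed.

End RightNormal.

(** * The integral of a normal quantum subgroup *)

Section CentralImage.
Context (k : fieldType) (H : hopfAlgType k) (M : lmodType k).
Context (rho : {linear M -> (M ⊗ H)%type}).
Hypothesis rhoM : right_comodule rho.

Lemma conv_central (w f : H -> k) : linf w -> linf f -> central w ->
  conv f w = conv w f.
Proof.
move=> lw lf cw; apply: funext => x; have := congr1 f (cw x).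
rewrite !(lin_tliftE _ _ lf) /conv => e; transitivity (f (\sw_(a, b <- comul x) (w b *: a))).
  by rewrite (lin_tliftE _ _ lf); apply: (@eq_tlift _ _ _ k^o) => a b; rewrite linfZ // mulrC.
rewrite (lin_tliftE _ _ lf) -e; apply: (@eq_tlift _ _ _ k^o) => a b.
by rewrite linfZ.
Qed.

(** A central functional acts by an endomorphism of the comodule. If this is not
    injective on [V], it sends a spanning family to one with a nontrivial
    relation. *)
Lemma central_image n (V : set M) (w : H -> k) m : linf w -> central w ->
  right_subcomodule rho V -> spanned n V -> V m -> m <> 0 -> act rho w m = 0 ->
  exists2 W, right_subcomodule rho W /\ W `<=` V &
    (forall v, V v -> W (act rho w v)) /\ exists2 n', (n' < n)%N & spanned n' W.
Proof.
move=> lw cw cV [v def_V] Vm m0 wm.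
have [sV Vact] := (subcomodule_act rho V).1 cV.
have la := act_lin rho lw.
pose W := [set y | exists2 x, V x & y = act rho w x].
have sW : subspace W by exact: subspace_im.
exists W; split.
- apply/subcomodule_act; split=> // f lf _ [x Vx ->].
  exists (act rho f x); first exact: Vact.
  by rewrite !act_conv // conv_central.
- by move=> _ [x Vx ->]; exact: Vact.
- by move=> x Vx; exists x.
have WE : W = span (act rho w \o v).
  apply/seteqP; split.
    move=> _ [x Vx ->]; move: Vx; rewrite def_V => -[c ->]; exists c.
    by rewrite (lin_sum _ _ _ la); apply: eq_bigr => i _; rewrite (linZ la).
  by apply: span_min => // i; exists (v i) => //; rewrite def_V; exact: mem_span.
have [c def_m] : span v m by rewrite -def_V.
have [i ci] : exists i, c i != 0.
  apply: contrapT => /forallNP nc; apply: m0; rewrite def_m big1 // => i _.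
  by have /negP := nc i; rewrite negbK => /eqP ->; rewrite scale0r.
case: n v def_V WE c def_m i ci => [|n] v def_V WE c def_m i ci; first by case: i ci.
exists n => //; exists (act rho w \o v \o lift i).
rewrite WE; apply: (span_drop _ ci); rewrite -[RHS]wm def_m (lin_sum _ _ _ la).
by apply: eq_bigr => j _; rewrite (linZ la).
Qed.

End CentralImage.

Section NormalIntegral.
Context (k : closedFieldType) (A B : hopfAlgType k) (p : {lrmorphism A -> B}).
Hypothesis hp : hopf_morphism p.
Hypothesis psurj : forall y : B, exists x : A, p x = y.
Hypothesis S2 : forall D : set B, simple_subcoalgebra D ->
  forall x, D x -> D (antipode (antipode x)).
Context (rho : {linear B -> (B ⊗ A)%type}).
Hypothesis rho_comodule : right_comodule rho.
Hypothesis rho_p : forall x, rho (p x) = tmap p idfun (adr x).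
Context (P : A -> A).
Hypotheses (lP : lin P) (PK : forall x, invariants p (P x))
  (Pid : forall x, invariants p x -> P x = x).
Hypothesis cP : forall x, comul (P x) = \sw_(a, b <- comul x) P a ⊗ b.
Local Notation L := [set x | P x = 0].

Lemma enough_central (g : B -> k) : linf g -> exists z : B -> k,
  [/\ linf z, central z & forall x, adr x = x ⊗ 1 -> z x = g x].
Proof.
move=> lg; exists (central_of rho P g); split; first exact: central_of_lin.
  exact: (central_of_central hp psurj rho_comodule rho_p lP PK cP).
move=> x; exact: (central_of_invariant hp psurj rho_comodule rho_p).
Qed.

(** Consider a subcomodule of [L] of least dimension whose image contains [1].
    A simple subcomodule of it is not trivial, since invariants in [L] vanish;
    hence some central functional kills it and fixes [1], and shrinks the
    subcomodule. *)
Lemma unit_notin_kernel n (V : set A) l : right_subcomodule (rhoB p) V ->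
  spanned n V -> V `<=` L -> V l -> p l = 1 -> False.
Proof.
elim/ltn_ind: n V l => n IHn V l cV sV VL Vl pl.
have V0 : V <> [set 0].
  move=> V0; move: Vl; rewrite V0 /= => l0.
  by have /eqP := pl; rewrite l0 linear0 eq_sym oner_eq0.
have [T [m [TV sT simT]]] := minimal_subcomodule cV sV V0.
have [n' [t [_ defT ft]]] := spanned_basis sT.
have [phi lphi phit] := free_dual ft.
have dual_t : dual_family t phi by [].
rewrite defT in TV simT.
have [cT T0 _] := simT.
have [triv|[w [lw cw w1 wT]]] :=
  trivial_or_killed (rhoB_comodule hp) S2 dual_t simT enough_central.
  apply: T0; apply/seteqP; split=> [x Tx|_ ->]; last by apply: sub0; exact: span_subspace.
  by rewrite /= -(Pid (triv x Tx)); exact: VL (TV x Tx).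
have [x [Tx x0]] : exists x, span t x /\ x <> 0.
  apply: contrapT => /forallNP nx; apply: T0; apply/seteqP; split=> [x Tx|_ ->].
    by apply: contrapT => x0; case: (nx x).
  by apply: sub0; exact: span_subspace.
have [W [cW WV] [Wact [m' m'n sW]]] :=
  central_image (rhoB_comodule hp) lw cw cV sV (TV x Tx) x0 (wT x Tx).
apply: (IHn m' m'n W (act (rhoB p) w l)) => //; first by move=> y /WV /VL.
  exact: Wact.
have lp : lin p by exact: lin_linear.
rewrite act_rhoB // /act (lin_tliftE _ _ lp).
transitivity (\sw_(c, d <- comul (p l)) (w d *: c)).
  rewrite comul_p; [|exact: hp|by linear_tac].
  by apply: eq_tlift => a b; rewrite (linZ lp).
by rewrite pl comul1_sum ?w1 ?scale1r //; linear_tac.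
Qed.

(** Hence [1] is not in the right coideal [p @` L], and a functional that vanishes
    on this coideal and is [1] at [1] is an integral. *)
Lemma normal_right_integral : exists h : B -> k, right_integral h.
Proof.
have lp : lin p by exact: lin_linear.
have cL : right_subcomodule (@comul k A) L by exact: subcomodule_ker.
have sL : subspace L by case: cL.
have [||h lh [hL h1]] := @separate k B [set y | exists2 x, L x & y = p x] 1.
- exact: subspace_im.
- move=> [l Ll pl].
  have [n sO] := orbit_spanned (rhoB_comodule hp) l.
  have [_ Lact] := (subcomodule_act _ _).1 (rhoB_subcomodule p cL).
  apply: (unit_notin_kernel (subcomodule_orbit (rhoB_comodule hp) l) sO) => //.
  + by move=> _ [f lf ->]; exact: Lact.
  + exact: (mem_orbit (rhoB_comodule hp)).
  + by [].
have hp_theta x : h (p x) = theta P x.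
  have -> : p x = p (P x) + p (x - P x) by rewrite -(linD lp) addrC subrK.
  rewrite linfD // [h (p (x - _))]hL ?addr0.
    by rewrite p_invariants // linfZ // h1 mulr1.
  by exists (x - P x) => //=; rewrite (linB lP) (Pid (PK x)) subrr.
exists h; split=> // y; have [x <-] := psurj y.
rewrite comul_p; [|exact: hp|by linear_tac].
rewrite hp_theta -(theta_p PK cP).
by apply: eq_tlift => a b; rewrite hp_theta.
Qed.

End NormalIntegral.

Lemma right_normal_integral (k : closedFieldType) (A B : hopfAlgType k)
    (p : {lrmorphism A -> B}) (h : A -> k) :
  hopf_morphism p -> (forall y : B, exists x : A, p x = y) ->
  left_integral h -> right_normal p ->
  (forall D : set B, simple_subcoalgebra D ->
     forall x, D x -> D (antipode (antipode x))) ->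
  exists h' : B -> k, right_integral h'.
Proof.
move=> hp psurj hl [rho [rho_comodule rho_p]] S2.
have [P [lP PK Pid cP]] := maschke (comul_comodule A) hl (invariants_subcomodule rho_p).
exact: (normal_right_integral hp psurj S2 rho_comodule rho_p lP PK Pid cP).
Qed.

(** * Injectivity of the antipode *)

Section AntipodeInjective.
Context (k : fieldType) (H : hopfAlgType k) (h : H -> k).
Local Notation S := (@antipode k H).
Hypothesis hr : right_integral h.

Let hl : left_integral h. Proof. exact: right_integral_left. Qed.
Let lh : linf h. Proof. by case: hr. Qed.

(** The elements orthogonal to everything form a left coideal on which the
    counit, being [h (S x1 * x2)], vanishes. *)
Lemma pairing_nondegenerate x : (forall y, h (S y * x) = 0) -> x = 0.
Proof.
move=> x0; pose N := [set z | forall y, h (S y * z) = 0].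
have sN : subspace N.
  split=> [y|a u v Nu Nv y] /=; first by rewrite mulr0 (linf0 lh).
  by rewrite mulrDr -scalerAr linfD // linfZ // Nu Nv mulr0 addr0.
have Nf (f : H -> k) z : linf f -> N z -> N (\sw_(a, b <- comul z) (f a *: b)).
  move=> lf Nz y /=; have ly : linf (fun z => h (S y * z)) by linear_tac.
  rewrite (lin_tliftE _ _ ly).
  transitivity (f (\sw_(c, d <- comul z) (h (S y * d) *: c))).
    rewrite (lin_tliftE _ _ lf); apply: (@eq_tlift _ _ _ k^o) => a b.
    by rewrite -scalerAr !linfZ // mulrC.
  rewrite left_integral_twist // (lin_tliftE _ _ lf) /tlift big1 // => i _.
  by rewrite Nz scale0r linf0.
have N0 z (F : H -> H -> k) : (@bilin k H H k^o F) -> N z ->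
    (forall a b, N b -> F a b = 0) -> \sw_(a, b <- comul z) (F a b : k^o) = 0.
  move=> bF Nz F0; have [F1 F2] := bF.
  rewrite -[comul z]tflipK tlift_flip // (eq_tlift_sub (N := N) (G := fun _ _ => 0)).
  - by rewrite /tlift big1.
  - by split.
  - by split=> ?; exact: lin_cst0.
  - by move=> v w Nv; exact: F0.
  - apply: tens_sub_of_contract => // f lf; rewrite tlift_flip; last by linear_tac.
    exact: Nf.
have N_counit z : N z -> counit z = 0 :> k.
  move=> Nz; have h1 : h 1 = 1 by case: hr.
  have := N0 z (fun a b => h (S a * b)); rewrite antipodelE // h1 /GRing.scale /= mulr1.
  by apply=> //; linear_tac.
apply: functional_eq => f lf; rewrite linf0 // -[x in LHS](counitr (f := fun z => z)) //.
rewrite (lin_tliftE _ _ lf).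
transitivity (\sw_(a, b <- comul x) (counit b * f a : k^o)).
  by apply: (@eq_tlift _ _ _ k^o) => a b; rewrite linfZ.
apply: (N0 x (fun a b => counit b * f a)) => //; first by linear_tac.
by move=> a b /N_counit ->; rewrite mul0r.
Qed.

(** On a finite-dimensional subcoalgebra [D] the pairing of the previous lemma
    restricts to a pairing of [D] with itself, since [D] is orthogonal to its
    complement; being nondegenerate on one side it is so on the other. *)
Lemma antipode_injective y : S y = 0 -> y = 0.
Proof.
move=> Sy; have HM := comul_comodule H.
have [n [t0 def_O]] := orbit_spanned HM y.
have [n' [t [_ def_O' ft]]] := spanned_basis (ex_intro _ t0 def_O).
have [phi lphi phit] := free_dual ft.
have tphi : dual_family t phi by [].
have cT : right_subcomodule comul (span t) by rewrite -def_O'; exact: subcomodule_orbit.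
pose u := coef comul t phi.
pose D := span (fun x : 'I_n' * 'I_n' => u x.1 x.2).
have [sD cD] : subcoalgebra D by exact: (coef_subcoalgebra HM tphi cT).
have Dy : D y.
  have : span t y by rewrite -def_O'; exact: mem_orbit.
  move=> [c ->]; apply: sub_sum => // j _; apply: subZ => //.
  rewrite -[t j](counitl (f := fun z => z)) // (rho_coef tphi cT) tlift_sum; last by linear_tac.
  by apply: sub_sum => // i _; apply: subZ => //; exact: mem_coef.
have cD' : right_subcomodule comul D.
  split=> // x /cD [s sDD ->]; exists s => // z /sDD [Dz _]; by [].
have [P [lP PD Pid cP]] := maschke HM hl cD'.
have orth x z : D x -> P z = 0 -> h (S z * x) = 0.
  move=> Dx Pz; pose r := \sw_(c, d <- comul x) (h (S z * c) *: d).
  have lz : linf (fun c => h (S z * c)) by linear_tac.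
  have Dr : D r.
    by apply: tens_sub_tlift (cD x Dx) => //; [linear_tac | move=> v w _ Dw; exact: subZ].
  have r0 : r = 0.
    rewrite -(Pid r Dr) /r -right_integral_shift // (lin_tliftE _ _ lP).
    transitivity (\sw_(a, b <- comul (P z)) (h (S b * x) *: a)).
      rewrite cP tlift_tlift; last by linear_tac.
      by apply: eq_tlift => a b; rewrite (linZ lP).
    rewrite Pz (lin0 (_ : lin (fun w => \sw_(a, b <- comul w) (h (S b * x) *: a)))) //.
    by linear_tac.
  have lcu : linf (@counit k H) by exact: lin_scalar.
  rewrite -[LHS](counitr (f := fun c => h (S z * c) : k^o)) // -[RHS](linf0 lcu) -r0.
  rewrite /r (lin_tliftE _ _ lcu).
  by apply: (@eq_tlift _ _ _ k^o) => a b; rewrite linfZ // mulrC.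
have nondeg x : D x -> (forall z, D z -> h (S z * x) = 0) -> x = 0.
  move=> Dx x0; apply: pairing_nondegenerate => z.
  have -> : z = P z + (z - P z) by rewrite addrC subrK.
  rewrite linearD mulrDl linfD // x0 // orth ?addr0 //.
  by rewrite (linB lP) (Pid _ (PD z)) subrr.
have [N [c [_ def_D fc]]] : exists N (c : 'I_N -> H),
    [/\ (N <= #|{: 'I_n' * 'I_n'}|)%N, D = span c & free c].
  apply: spanned_basis; exists (fun i => let x := enum_val i in u x.1 x.2).
  apply/seteqP; split; last by apply: span_min => // i; exact: mem_coef.
  apply: span_min => [|x]; first exact: span_subspace.
  rewrite -(enum_rankK x).
  exact: (mem_span (fun i => let x := enum_val i in u x.1 x.2) (enum_rank x)).
pose G : 'M[k]_N := \matrix_(i, j) h (S (c j) * c i).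
have lSx x : linf (fun z => h (S z * x)) by linear_tac.
have lSy z : linf (fun x => h (S z * x)) by linear_tac.
have Gunit : G \in unitmx.
  rewrite -row_free_unit; apply: inj_row_free => v vG.
  pose x := \sum_i v 0 i *: c i.
  have x0 : x = 0.
    apply: nondeg; first by rewrite def_D; exists (v 0).
    move=> z; rewrite def_D => -[d ->].
    rewrite (linf_sum _ _ _ (lSx x)) big1 // => j _; rewrite (linfZ _ _ (lSx x)).
    rewrite (linf_sum _ _ _ (lSy (c j))).
    transitivity (d j * (v *m G) 0 j); last by rewrite vG mxE mulr0.
    congr (_ * _); rewrite mxE; apply: eq_bigr => i _.
    by rewrite (linfZ _ _ (lSy (c j))) mxE.
  by apply/rowP => i; rewrite mxE (fc _ x0).
have [d def_y] : span c y by rewrite -def_D.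
pose w : 'cV[k]_N := \col_j d j.
have Gw : G *m w = 0.
  apply/colP => i; rewrite !mxE -[RHS](linf0 lh) -[RHS]/(h 0) -(mul0r (c i)) -Sy def_y.
  rewrite (linf_sum _ _ _ (lSx (c i))); apply: eq_bigr => j _.
  by rewrite (linfZ _ _ (lSx (c i))) !mxE mulrC.
have w0 : w = 0 by rewrite -(mulKmx Gunit w) Gw mulmx0.
rewrite def_y big1 // => j _; have := congr1 (fun v : 'cV_N => v j 0) w0.
by rewrite !mxE => ->; rewrite scale0r.
Qed.

End AntipodeInjective.

(** * From right-normal to left-normal *)

Section RightToLeft.
Context (k : fieldType) (A B : hopfAlgType k) (p : {lrmorphism A -> B}).
Local Notation SA := (@antipode k A).
Local Notation SB := (@antipode k B).
Hypothesis hp : hopf_morphism p.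
Hypothesis psurj : forall y : B, exists x : A, p x = y.
Hypothesis SA_inj : forall x : A, SA x = 0 -> x = 0.
Hypothesis SB_inj : forall x : B, SB x = 0 -> x = 0.

Let lp : lin p. Proof. exact: lin_linear. Qed.

Definition adlp (x : A) : (A ⊗ B)%type := tmap idfun p (adl x).

Lemma adlp_sum (X : lmodType k) (F : A -> B -> X) x : bilin F -> tlift F (adlp x) =
  \sw_(a, b <- comul x) \sw_(a1, a2 <- comul a) F (a1 * SA b) (p a2).
Proof.
move=> bF; have [F1 F2] := bF; rewrite /adlp /tmap tlift_tlift // adl_sum //.
by linear_tac.
Qed.

Lemma adlp_lin : lin adlp.
Proof.
move=> a x y; rewrite -[LHS]tlift_id -[adlp x]tlift_id -[adlp y]tlift_id.
rewrite !adlp_sum; [|by linear_tac..].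
have lF : lin (fun x => \sw_(a, b <- comul x) \sw_(a1, a2 <- comul a)
  (a1 * SA b) ⊗ p a2) by linear_tac.
exact: lF.
Qed.

(** The antipode exchanges the two adjoint coactions, up to a flip. *)
Lemma adlp_kernel x : right_normal p -> p x = 0 -> adlp x = 0.
Proof.
move=> [rho [_ rho_p]] px.
have lSA : lin SA by exact: lin_linear.
have lSB : lin SB by exact: lin_linear.
have [_ _ pS] := hp.
apply: (tensor_map_inj lSA lSB) => //.
rewrite adlp_sum; last by linear_tac.
rewrite coassoc; last by trilinear_tac.
have e : tmap p idfun (adr (SA x)) = 0 by rewrite -rho_p -pS px !linear0.
rewrite -[RHS](lin0 (@tflip_lin k B A)) -e /tflip /tmap tlift_tlift; last by linear_tac.
rewrite adr_sum; last by linear_tac.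
rewrite comul_antipode; last by linear_tac.
apply: eq_tlift => a b; rewrite comul_antipode; last by linear_tac.
by apply: eq_tlift => b1 b2; rewrite pS antipodeM.
Qed.

Hypothesis rn : right_normal p.

Lemma right_normal_left_normal : left_normal p.
Proof.
have [s sK] := choice psurj.
have adlp_p x y : p x = p y -> adlp x = adlp y.
  move=> pxy; apply/eqP; rewrite -subr_eq0; apply/eqP; rewrite -(linB adlp_lin).
  by apply: adlp_kernel => //; rewrite linearB /= pxy subrr.
have lrho : lin (fun b => adlp (s b)).
  by move=> a b c; rewrite -adlp_lin; apply: adlp_p; rewrite lp !sK.
pose rho := linmap lrho.
have rho_p x : rho (p x) = adlp x by rewrite /rho /=; apply: adlp_p; rewrite sK.
exists rho; split=> //.
(* Both sides are x1 S(x5) ⊗ (x2 S(x4) ⊗ p(x3)). *)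
apply: left_comodule_intro => y; have [x <-] := psurj y; rewrite !rho_p.
  rewrite !adlp_sum; [|by linear_tac..].
  transitivity (\sw_(a, v <- comul x) \sw_(e, w <- comul v) \sw_(e1, e2 <- comul e)
      \sw_(b1, b2 <- comul w) (a * SA b2) ⊗ ((e1 * SA b1) ⊗ p e2)).
    transitivity (\sw_(a, b <- comul x) \sw_(a1, w <- comul a) \sw_(e1, e2 <- comul w)
        \sw_(b1, b2 <- comul b) (a1 * SA b2) ⊗ ((e1 * SA b1) ⊗ p e2)).
      apply: eq_tlift => a b.
      rewrite -(coassoc (F := fun a1 e1 e2 => \sw_(b1, b2 <- comul b)
        (a1 * SA b2) ⊗ ((e1 * SA b1) ⊗ p e2))); last by trilinear_tac.
      apply: eq_tlift => a1 a2; rewrite comulM_sum; last by linear_tac.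
      by apply: eq_tlift => d1 d2; rewrite comul_antipode //; linear_tac.
    rewrite (coassoc (F := fun a w b => \sw_(e1, e2 <- comul w)
      \sw_(b1, b2 <- comul b) (a * SA b2) ⊗ ((e1 * SA b1) ⊗ p e2))) //.
    by trilinear_tac.
  transitivity (\sw_(a, b <- comul x) \sw_(a1, a2 <- comul a)
      \sw_(e, f <- comul a2) \sw_(e1, e2 <- comul e)
        (a1 * SA b) ⊗ ((e1 * SA f) ⊗ p e2)); last first.
    apply: eq_tlift => a b; apply: eq_tlift => a1 a2; rewrite rho_p adlp_sum //.
    by linear_tac.
  rewrite (coassoc (F := fun a1 a2 b => \sw_(e, f <- comul a2) \sw_(e1, e2 <- comul e)
    (a1 * SA b) ⊗ ((e1 * SA f) ⊗ p e2))); last by trilinear_tac.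
  apply: eq_tlift => a v.
  rewrite (coassoc (F := fun e f b => \sw_(e1, e2 <- comul e)
    (a * SA b) ⊗ ((e1 * SA f) ⊗ p e2))); last by trilinear_tac.
  by apply: eq_tlift => e w; rewrite exchange_tlift.
rewrite adlp_sum; last by linear_tac.
rewrite -[RHS](counitr (f := p)) //; apply: eq_tlift => a b.
rewrite -(counitl (f := p)) // (lin_tliftE _ _ (lin_scaler _ (@lin_id _ _))).
by apply: eq_tlift => a1 a2; rewrite counitM counit_antipode scalerA mulrC.
Qed.

End RightToLeft.

(** * The opposite, co-opposite Hopf algebra *)

Section OpCop.
Context (k : fieldType) (A : hopfAlgType k).

(** [A] with both products and coproducts reversed has the same antipode, and
    exchanges left and right throughout. *)
Definition opcop : Type := A.

HB.instance Definition _ := GRing.Lmodule.copy opcop A.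

Let omul (x y : opcop) : opcop := (y : A) * (x : A).

Fact omulA : associative omul.
Proof. by move=> x y z; rewrite /omul mulrA. Qed.
Fact omul1 : left_id (1 : A) omul.
Proof. by move=> x; exact: mulr1. Qed.
Fact omulr1 : right_id (1 : A) omul.
Proof. by move=> x; exact: mul1r. Qed.
Fact omulDl : left_distributive omul +%R.
Proof. by move=> x y z; exact: mulrDr. Qed.
Fact omulDr : right_distributive omul +%R.
Proof. by move=> x y z; exact: mulrDl. Qed.
Fact oone_neq0 : (1 : A) != (0 : opcop).
Proof. exact: oner_neq0. Qed.

HB.instance Definition _ := GRing.Zmodule_isNzRing.Build opcop
  omulA omul1 omulr1 omulDl omulDr oone_neq0.

Fact oscalerAl (a : k) (x y : opcop) : a *: (x * y : opcop) = (a *: x : opcop) * y.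
Proof. exact (scalerAr a (y : A) (x : A)). Qed.

HB.instance Definition _ := GRing.Lmodule_isLalgebra.Build k opcop oscalerAl.

Fact oscalerAr (a : k) (x y : opcop) : a *: (x * y : opcop) = x * (a *: y : opcop).
Proof. exact (scalerAl a (y : A) (x : A)). Qed.

HB.instance Definition _ := GRing.Lalgebra_isAlgebra.Build k opcop oscalerAr.

Definition ocomul (x : opcop) : (opcop ⊗ opcop)%type := tflip (comul (x : A)).

Fact ocomul_lin : @lin k opcop (opcop ⊗ opcop)%type ocomul.
Proof. by move=> a x y; rewrite /ocomul linearP; exact: tflip_lin. Qed.

Lemma ocomul_sum (X : lmodType k) (F : opcop -> opcop -> X) (x : opcop) : bilin F ->
  tlift F (ocomul x) = \sw_(a, b <- comul (x : A)) F b a.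
Proof. by move=> bF; exact: tlift_flip. Qed.

Fact ocomulA (x : opcop) : tassoc (tmap (linmap ocomul_lin) idfun (linmap ocomul_lin x)) =
  tmap idfun (linmap ocomul_lin) (linmap ocomul_lin x).
Proof.
have lo := ocomul_lin.
rewrite tassoc_tmap // tmap_sum // /=.
rewrite !ocomul_sum; [|by linear_tac..].
under eq_tlift => a b do (rewrite ocomul_sum; last by linear_tac).
under [RHS]eq_tlift => a b do (rewrite ocomul_sum; last by linear_tac).
rewrite [RHS](@coassoc _ A _ (fun a1 a2 b =>
  (b : opcop) ⊗ ((a2 : opcop) ⊗ (a1 : opcop)))) //.
by trilinear_tac.
Qed.

Fact ocomul_counitl (x : opcop) :
  tlift (fun a b : opcop => counit (a : A) *: b) (linmap ocomul_lin x) = x.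
Proof.
have lc : @lin k opcop k^o (@counit k A) by exact: (lin_scalar (@counit k A)).
rewrite /= ocomul_sum; last by linear_tac.
exact: (@comul_counitr k A).
Qed.

Fact ocomul_counitr (x : opcop) :
  tlift (fun a b : opcop => counit (b : A) *: a) (linmap ocomul_lin x) = x.
Proof.
have lc : @lin k opcop k^o (@counit k A) by exact: (lin_scalar (@counit k A)).
rewrite /= ocomul_sum; last by linear_tac.
exact: (@comul_counitl k A).
Qed.

HB.instance Definition _ := isCoalgebra.Build k opcop
  ocomulA ocomul_counitl ocomul_counitr.

Lemma comul_opcop (X : lmodType k) (F : opcop -> opcop -> X) (x : opcop) : bilin F ->
  tlift F (comul x) = \sw_(a, b <- comul (x : A)) F b a.
Proof. exact: ocomul_sum. Qed.

Fact ocomulM (x y : opcop) : comul (x * y) = tmul (comul x) (comul y).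
Proof.
rewrite -[LHS]tlift_id comul_opcop; last by linear_tac.
have -> : tmul (comul x) (comul y) = \sw_(a, b <- comul (x : A)) \sw_(c, d <- comul (y : A))
    ((b : opcop) * (d : opcop)) ⊗ ((a : opcop) * (c : opcop)).
  rewrite /tmul comul_opcop; last first.
    by split=> ?; linear_tac.
  by apply: eq_tlift => a b; rewrite comul_opcop //; linear_tac.
rewrite [x * y](_ : _ = (y : A) * (x : A)) // comulM_sum; last by linear_tac.
by rewrite exchange_tlift.
Qed.

Fact ocomul1 : comul (1 : opcop) = 1 ⊗ 1.
Proof.
rewrite -[LHS]tlift_id comul_opcop; last by linear_tac.
by rewrite [1](_ : _ = (1 : A)) // comul1_sum //; linear_tac.
Qed.

Fact ocounitM (x y : opcop) : counit (x * y) = counit x * counit y.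
Proof. by rewrite mulrC; exact: (@counitM k A). Qed.

Fact ocounit1 : counit (1 : opcop) = 1.
Proof. exact: (@counit1 k A). Qed.

HB.instance Definition _ := isBialgebra.Build k opcop ocomulM ocomul1 ocounitM ocounit1.

Fact oantipode_lin : @lin k opcop opcop (@antipode k A).
Proof. by move=> a x y; exact: linearP. Qed.

Fact oantipodel (x : opcop) :
  tlift (fun a b : opcop => linmap oantipode_lin a * b) (comul x) = counit x *: 1.
Proof.
have ls := oantipode_lin.
rewrite comul_opcop /=; last by linear_tac.
exact: (@antipoder k A).
Qed.

Fact oantipoder (x : opcop) :
  tlift (fun a b : opcop => a * linmap oantipode_lin b) (comul x) = counit x *: 1.
Proof.
have ls := oantipode_lin.
rewrite comul_opcop /=; last by linear_tac.
exact: (@antipodel k A).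
Qed.

HB.instance Definition _ := isHopfAlgebra.Build k opcop oantipodel oantipoder.

Lemma opcop_left_integral (h : A -> k) : right_integral h -> @left_integral k opcop h.
Proof.
move=> [lh h1 hx]; split=> // x; have lh' : @lin k opcop k^o h by exact: lh.
rewrite comul_opcop; last by linear_tac.
exact: hx.
Qed.

Lemma opcop_right_integral (h : A -> k) : left_integral h -> @right_integral k opcop h.
Proof.
move=> [lh h1 hx]; split=> // x; have lh' : @lin k opcop k^o h by exact: lh.
rewrite comul_opcop; last by linear_tac.
exact: hx.
Qed.

End OpCop.

Lemma tens_sub_flip (k : fieldType) (V W : lmodType k) (N : set V) (P : set W) t :
  subspace P -> tens_sub N P t -> tens_sub P N (tflip t).
Proof.
move=> sP; apply: tens_sub_tlift; first by linear_tac.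
  exact: tens_sub_subspace.
by move=> v w Nv Pw; exact: tens_sub_pure.
Qed.

Section OpCopTransfer.
Context (k : fieldType) (H : hopfAlgType k).
Local Notation Ho := (opcop H).

Lemma right_integral_opcop (h : H -> k) : @left_integral k Ho h -> right_integral h.
Proof.
move=> [lh h1 hx]; have lh' : @lin k H k^o h by exact: lh.
split=> // x; rewrite -[RHS](hx x) comul_opcop //.
by linear_tac.
Qed.

Lemma subcoalgebra_opcop (D : set H) : @subcoalgebra k Ho D <-> @subcoalgebra k H D.
Proof.
split=> -[sD cD]; split=> // x /cD; last exact: tens_sub_flip.
by move=> /(tens_sub_flip sD); rewrite (tflipK (comul (x : H))).
Qed.

Lemma simple_subcoalgebra_opcop (D : set H) :
  @simple_subcoalgebra k Ho D -> @simple_subcoalgebra k H D.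
Proof.
move=> [cD D0 minD]; split=> // [|P cP PD]; first exact/subcoalgebra_opcop.
by apply: minD => //; exact/subcoalgebra_opcop.
Qed.

Section Comodule.
Context (M : lmodType k).

Lemma left_comodule_opcop (rho : {linear M -> (H ⊗ M)%type})
    (rho' : {linear M -> (M ⊗ Ho)%type}) :
  (forall m, rho' m = tflip (rho m)) -> left_comodule rho -> right_comodule rho'.
Proof.
move=> rhoE rhoM; have lc : lin (@comul k H) by exact: lin_linear.
have lo := @ocomul_lin k H.
apply: right_comodule_intro => m; rewrite !rhoE.
  rewrite !tlift_flip; [|by linear_tac..].
  transitivity (\sw_(c, n <- rho m) \sw_(c1, n1 <- rho n) n1 ⊗ ((c1 : Ho) ⊗ (c : Ho))).
    by apply: eq_tlift => c n; rewrite rhoE tlift_flip //; linear_tac.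
  rewrite -(@coact_suml k H M rho _ (fun c c1 n1 => n1 ⊗ ((c1 : Ho) ⊗ (c : Ho)))) //;
    last by trilinear_tac.
  by apply: eq_tlift => c n; rewrite [RHS](@comul_opcop k H) //; linear_tac.
rewrite tlift_flip; last by linear_tac.
by have [_] := rhoM; apply.
Qed.

Lemma left_comodule_of_opcop (rho : {linear M -> (Ho ⊗ M)%type})
    (rho' : {linear M -> (M ⊗ H)%type}) :
  (forall m, rho' m = tflip (rho m)) -> left_comodule rho -> right_comodule rho'.
Proof.
move=> rhoE rhoM; have lc : lin (@comul k H) by exact: lin_linear.
have lo := @ocomul_lin k H.
apply: right_comodule_intro => m; rewrite !rhoE.
  rewrite !tlift_flip; [|by linear_tac..].
  transitivity (\sw_(c, n <- rho m) \sw_(c1, n1 <- rho n) n1 ⊗ ((c1 : H) ⊗ (c : H))).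
    by apply: eq_tlift => c n; rewrite rhoE tlift_flip //; linear_tac.
  rewrite -(@coact_suml k Ho M rho _ (fun c c1 n1 => n1 ⊗ ((c1 : H) ⊗ (c : H)))) //;
    last by trilinear_tac.
  by apply: eq_tlift => c n; rewrite comul_opcop //; linear_tac.
rewrite tlift_flip; last by linear_tac.
by have [_] := rhoM; apply.
Qed.

Lemma left_subcomodule_opcop (rho : {linear M -> (H ⊗ M)%type})
    (rho' : {linear M -> (M ⊗ Ho)%type}) :
  (forall m, rho' m = tflip (rho m)) ->
  right_subcomodule rho' = left_subcomodule rho.
Proof.
move=> rhoE; apply: funext => N; apply: propext.
split=> -[sN cN]; split=> // m /cN; rewrite ?rhoE.
  by move=> /(@tens_sub_flip k M H N setT); rewrite tflipK; apply.
by apply: tens_sub_flip.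
Qed.

End Comodule.

Lemma integral_cosemisimple (h : H -> k) : right_integral h -> cosemisimple H.
Proof.
move=> hr; split=> M rho rhoM.
  by apply: left_integral_semisimple rhoM; exact: right_integral_left hr.
have lf : lin (fun m => tflip (rho m) : (M ⊗ Ho)%type).
  by apply: (lin_comp (@tflip_lin k H M)); exact: lin_linear.
have rhoE m : linmap lf m = tflip (rho m) by [].
rewrite -(left_subcomodule_opcop rhoE).
by apply: left_integral_semisimple (left_comodule_opcop rhoE rhoM); exact: opcop_left_integral hr.
Qed.

End OpCopTransfer.

Section OpCopMap.
Context (k : fieldType) (A B : hopfAlgType k) (p : {lrmorphism A -> B}).

Definition opcop_map : opcop A -> opcop B := p.

Fact opcop_map_linear : linear opcop_map.
Proof. exact: (linearP p). Qed.

Fact opcop_map_monoid : monoid_morphism opcop_map.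
Proof. by split=> [|x y]; [exact: (rmorph1 p) | exact: (rmorphM p (y : A) (x : A))]. Qed.

HB.instance Definition _ := GRing.isLinear.Build k (opcop A) (opcop B) *:%R
  opcop_map opcop_map_linear.
HB.instance Definition _ := GRing.isMonoidMorphism.Build (opcop A) (opcop B)
  opcop_map opcop_map_monoid.

Definition opcop_lrmorphism : {lrmorphism opcop A -> opcop B} := opcop_map.

Hypothesis hp : hopf_morphism p.

Lemma opcop_hopf_morphism : hopf_morphism opcop_lrmorphism.
Proof.
have [pc pe pS] := hp; split=> x; [|exact: pe|exact: pS].
have lp : lin p by exact: lin_linear.
have lc : @lin k (opcop A) (opcop B ⊗ opcop B)%type (fun x => ocomul (p x)).
  by apply: (lin_comp (@ocomul_lin k B)).
rewrite /tmap (@comul_opcop k A) //; last by linear_tac.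
transitivity (\sw_(a, b <- comul (p x)) (b : opcop B) ⊗ (a : opcop B)).
  rewrite -[LHS]tlift_id (@comul_opcop k B) //.
  by linear_tac.
rewrite pc /tmap tlift_tlift //.
by linear_tac.
Qed.

Let lp : lin p. Proof. exact: lin_linear. Qed.
Let lSA : lin (@antipode k A). Proof. exact: lin_linear. Qed.

Lemma adr_opcop (x : A) : tflip (tmap idfun p (adl x)) =
  tmap opcop_lrmorphism idfun (@adr k (opcop A) x).
Proof.
have lp' : @lin k (opcop A) (opcop B) opcop_map by exact: lp.
have lS' : @lin k (opcop A) (opcop A) (@antipode k A) by exact: lSA.
have lo := @ocomul_lin k A.
have lm (c : opcop A) : @lin k (opcop A) (opcop A) (fun z => c * z).
  exact: (@lin_mulr k (opcop A) (opcop A) _ c (@lin_id k (opcop A))).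
rewrite /tflip /tmap tlift_tlift; last by linear_tac.
rewrite adl_sum; last by linear_tac.
rewrite (@adr_sum k (opcop A)) /=; last by linear_tac.
rewrite (@comul_opcop k A); last by linear_tac.
rewrite coassoc; last by trilinear_tac.
apply: eq_tlift => a b; rewrite (@comul_opcop k A); last by linear_tac.
by [].
Qed.

Lemma left_normal_opcop : left_normal p -> right_normal opcop_lrmorphism.
Proof.
move=> [rho [rhoM rho_p]].
have lf : @lin k (opcop B) (opcop B ⊗ opcop A)%type (fun b => tflip (rho b)).
  by apply: (lin_comp (@tflip_lin k A B)); exact: lin_linear.
exists (linmap lf); split; first exact: (left_comodule_opcop (rho' := linmap lf) _ rhoM).
by move=> x; rewrite /= rho_p; exact: adr_opcop.
Qed.

Lemma adr_of_opcop (x : A) :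
  tflip (tmap idfun opcop_lrmorphism (@adl k (opcop A) x)) = tmap p idfun (@adr k A x).
Proof.
have lp' : @lin k (opcop A) (opcop B) opcop_map by exact: lp.
have lS' : @lin k (opcop A) (opcop A) (@antipode k A) by exact: lSA.
have lo := @ocomul_lin k A.
have lm (c : opcop A) : @lin k (opcop A) (opcop A) (fun z => c * z).
  exact: (@lin_mulr k (opcop A) (opcop A) _ c (@lin_id k (opcop A))).
rewrite /tflip /tmap tlift_tlift; last by linear_tac.
rewrite (@adl_sum k (opcop A)) /=; last by linear_tac.
rewrite [RHS](@adr_sum k A _ (fun v w => p v ⊗ w)); last by linear_tac.
rewrite (@comul_opcop k A); last by linear_tac.
rewrite [RHS]coassoc; last by trilinear_tac.
apply: eq_tlift => a b; rewrite (@comul_opcop k A); last by linear_tac.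
by [].
Qed.

Lemma right_normal_of_opcop : left_normal opcop_lrmorphism -> right_normal p.
Proof.
move=> [rho [rhoM rho_p]].
have lf : @lin k B (B ⊗ A)%type (fun b => tflip (rho b)).
  by apply: (lin_comp (@tflip_lin k (opcop A) (opcop B))); exact: lin_linear.
exists (linmap lf); split; first exact: (left_comodule_of_opcop (rho' := linmap lf) _ rhoM).
by move=> x; rewrite /= -adr_of_opcop -rho_p.
Qed.

End OpCopMap.

(** * Linear reductivity and two-sided normality *)

Lemma right_normal_reductive (k : closedFieldType) (A B : hopfAlgType k)
    (p : {lrmorphism A -> B}) (h : A -> k) :
  hopf_morphism p -> (forall y : B, exists x : A, p x = y) ->
  right_integral h -> right_normal p ->
  (forall D : set B, simple_subcoalgebra D ->
     forall x, D x -> D (antipode (antipode x))) ->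
  (exists h' : B -> k, right_integral h') /\ left_normal p.
Proof.
move=> hp psurj hr rn S2.
have [h' hr'] := right_normal_integral hp psurj (right_integral_left hr) rn S2.
split; first by exists h'.
exact: (right_normal_left_normal hp psurj (antipode_injective hr) (antipode_injective hr')).
Qed.

Theorem theorem2p2 (k : closedFieldType) (OG OH : hopfAlgType k)
    (p : {lrmorphism OG -> OH})
    (hp : hopf_morphism p) (psurj : forall y : OH, exists x : OG, p x = y)
    (ssG : cosemisimple OG)
    (lrnormal : left_normal p \/ right_normal p)
    (S2 : forall D : set OH, simple_subcoalgebra D ->
       forall x, D x -> D (antipode (antipode x))) :
  cosemisimple OH /\ (left_normal p /\ right_normal p).
Proof.
have [h hr] := cosemisimple_right_integral ssG.
case: lrnormal => [ln|rn]; last first.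
  have [[h' hr'] ln] := right_normal_reductive hp psurj hr rn S2.
  by split=> //; exact: integral_cosemisimple hr'.
have hro := opcop_right_integral (right_integral_left hr).
have S2o (D : set (opcop OH)) : simple_subcoalgebra D ->
    forall x, D x -> D (antipode (antipode x)).
  by move=> /simple_subcoalgebra_opcop; exact: S2.
have [[h' hr'] lno] := right_normal_reductive (opcop_hopf_morphism hp) psurj hro
  (left_normal_opcop ln) S2o.
split; last by split=> //; exact: right_normal_of_opcop lno.
exact: integral_cosemisimple (right_integral_opcop (right_integral_left hr')).
Qed.
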